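(* Let $f\in H^2(\mathbf D)$, where $\mathbf D$ is the open unit disc. Put $f_1=f$ and, inductively for $k\ge 1$, let $a_k\in\mathbf D$ be a point at which the maximum $$\max\{(1-|a|^2)\,|f_k(a)|^2\ :\ a\in\mathbf D\}$$ is attained (such a point exists at each step), and define $$f_{k+1}(z)=\frac{f_k(z)-\langle f_k,e_{a_k}\rangle e_{a_k}(z)}{\dfrac{z-a_k}{1-\overline{a_k}z}}.$$ Let $$B_k(z)=\frac{\sqrt{1-|a_k|^2}}{1-\overline{a_k}z}\prod_{l=1}^{k-1}\frac{z-a_l}{1-\overline{a_l}z},\qquad k\ge1.$$ Then, with convergence in the norm of $H^2(\mathbf D)$, $$f=\sum_{k=1}^\infty\langle f_k,e_{a_k}\rangle B_k .$$
   Context: $H^2(\mathbf D)$ is the Hardy space of holomorphic functions $f(z)=\sum_{l\ge0}c_lz^l$ on $\mathbf D$ with $\sum|c_l|^2<\infty$, with inner product $\langle f,g\rangle=\frac1{2\pi}\int_0^{2\pi}f(e^{it})\overline{g(e^{it})}\,dt$ (boundary values). For $a\in\mathbf D$, $e_a(z)=\frac{\sqrt{1-|a|^2}}{1-\overline a z}$ is the normalized Szegő kernel, so that $\langle f,e_a\rangle=\sqrt{1-|a|^2}\,f(a)$. The functions $f_k$ belong to $H^2(\mathbf D)$ (the quotient defining $f_{k+1}$ has a removable singularity at $a_k$). The points $a_k$ need not be distinct. *)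

(* Defs.v *)
From HB Require Import structures.
From mathcomp Require Import all_boot all_order all_algebra.
From mathcomp Require Import all_classical all_reals all_analysis.
From mathcomp Require Import complex.

Set Implicit Arguments.
Unset Strict Implicit.
Unset Printing Implicit Defensive.

Import Order.TTheory GRing.Theory Num.Theory.
Import numFieldNormedType.Exports.
Import ComplexField.Normc.

Local Open Scope classical_set_scope.
Local Open Scope ring_scope.
Local Open Scope complex_scope.

(* R[i] as a normed module over itself, with the topology of the modulus: the
   structure that every numFieldType carries through its regular module. *)
HB.instance Definition _ (R : realType) :=
  PseudoPointedMetric.copy R[i] R[i]^o.
HB.instance Definition _ (R : realType) := NormedModule.copy R[i] R[i]^o.

(* A function on the open unit disc is represented by a total function on
   R[i]; none of the notions below depends on its values outside the disc. *)
Section Hardy.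
Context {R : realType}.
Implicit Types (f g : R[i] -> R[i]) (a z : R[i]) (t : R).

Definition unit_disc : set R[i] := [set z | normc z < 1].

Definition hardy2 f : Prop :=
  exists c : nat -> R[i],
    (\sum_(0 <= l <oo) ((normc (c l)) ^+ 2)%:E < +oo)%E /\
    (forall z, unit_disc z ->
       series (fun l => c l * z ^+ l) @ \oo --> f z).

Definition expi t : R[i] := cos t +i* sin t.

(* Radial boundary value f(e^{it}); the limit exists for almost every t when
   f is in the Hardy space, and is a junk value where it does not exist. *)
Definition bdry f t : R[i] := lim ((fun r : R => f (r%:C * expi t)) @ 1^'-).

Definition Cintegral (D : set R) (h : R -> R[i]) : R[i] :=
  (\int[lebesgue_measure]_(t in D) complex.Re (h t))
  +i* (\int[lebesgue_measure]_(t in D) complex.Im (h t)).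

Definition h2dot f g : R[i] :=
  ((2 * pi)^-1)%:C *
  Cintegral `[0, 2 * pi] (fun t => bdry f t * (bdry g t)^*).

Definition h2norm f : R := Num.sqrt (complex.Re (h2dot f f)).

Definition szego a z : R[i] :=
  (Num.sqrt (1 - normc a ^+ 2))%:C / (1 - a^* * z).

Definition blaschke a z : R[i] := (z - a) / (1 - a^* * z).

Definition is_maximizer f a : Prop :=
  unit_disc a /\
  forall b, unit_disc b ->
    (1 - normc b ^+ 2) * normc (f b) ^+ 2
      <= (1 - normc a ^+ 2) * normc (f a) ^+ 2.

(* The quotient, with its removable singularity at a removed. *)
Definition reduce f a : R[i] -> R[i] :=
  let q z := (f z - h2dot f (szego a) * szego a z) / blaschke a z in
  fun z => if z == a then lim (q w @[w --> a^']) else q z.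

(* Indices start at 0: remainder a f k and blaschke_atom a k are f_{k+1} and
   B_{k+1} for the points a_1, a_2, ... numbered a 0, a 1, ... *)
Fixpoint remainder (a : nat -> R[i]) f (k : nat) : R[i] -> R[i] :=
  if k is j.+1 then reduce (remainder a f j) (a j) else f.

Definition blaschke_atom (a : nat -> R[i]) (k : nat) z : R[i] :=
  (Num.sqrt (1 - normc (a k) ^+ 2))%:C / (1 - (a k)^* * z)
  * \prod_(l < k) blaschke (a l) z.

End Hardy.

(* Main.v *)
Require Import Defs.
From HB Require Import structures.
From mathcomp Require Import all_boot all_order all_algebra.
From mathcomp Require Import all_classical all_reals all_analysis.
From mathcomp Require Import measurable_realfun.
From mathcomp Require Import complex ring lra.
Import Order.TTheory GRing.Theory Num.Theory.
Import numFieldNormedType.Exports.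
Import ComplexField.Normc.
Local Open Scope classical_set_scope.
Local Open Scope ring_scope.
Local Open Scope complex_scope.

Set Implicit Arguments.
Unset Strict Implicit.
Unset Printing Implicit Defensive.

Local Notation Re := complex.Re.
Local Notation Im := complex.Im.

(* Proof idea. On power series with square-summable coefficients, the map
   (sg, W) |-> sg * szego a + (z - a) W is, up to a telescoping boundary term,
   orthogonal and isometric with W |-> (1 - conj(a) z) W, so one greedy step gives
   |f_k|^2 = |<f_k, e_(a_k)>|^2 + |f_(k+1)|^2. The residuals
   r_n = (prod_(k < n) blaschke a_k) f_n satisfy |r_n| = |f_n| and r_n is orthogonal
   to f - r_n. Since (1 - |b|^2) |f_n(b)|^2 <= |<f_n, e_(a_n)>|^2 -> 0, the r_n tend
   to 0 pointwise in the disc, hence weakly, and |r_n|^2 = <r_n, f> -> 0.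
   The boundary inner product agrees with evaluation because of Fatou's theorem:
   the radial maximal function is dominated by the Hardy-Littlewood maximal
   function through the Poisson kernel, so radial limits exist almost everywhere,
   and Fatou's lemma bounds their L2 norm by the l2 norm of the coefficients. *)

(** The inner product of the statement integrates radial limits, while the greedy algebra lives on
    coefficient sequences. Two facts cross from one side to the other: [h2norm_le], an upper bound
    of the boundary norm by the coefficient norm, and [h2dot_szego], the evaluation formula.
    Isometry and orthogonality are settled on coefficients. Orthogonality is carried as a norm
    identity for [|f - x r|^2] with real [x], so no inner product of sequences is defined; [x = -1]
    extracts the cross term at the end. The obstacle is that [bdry] is a default value where the
    radial limit fails to exist: existence almost everywhere and measurability both have to be
    earned, and the exceptional set is controlled by a weak-type estimate, first for polynomials,
    then for series, then for tails of small norm. In these estimates Cauchy-Schwarz is replaced by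
    an arithmetic-geometric inequality with a free parameter [eta]. A maximizing point exists
    because [(1 - |b|^2) |f(b)|^2] tends to 0 at the circle, which reduces the search to a compact
    disc. *)

Section complex_basics.
Context {R : realType}.
Implicit Types (z w : R[i]) (x y : R).

Lemma norm_normc z : `|z| = (normc z)%:C. Proof. by []. Qed.

Lemma normc_ge0 z : 0 <= normc z. Proof. by case: z => x y; exact: sqrtr_ge0. Qed.

Lemma normc_zero : normc (0 : R[i]) = 0. Proof. exact: normc0. Qed.

Lemma normc_one : normc (1 : R[i]) = 1. Proof. exact: normc1. Qed.

Lemma normc_real x : normc x%:C = `|x|.
Proof. by rewrite /= expr0n addr0 sqrtr_sqr. Qed.

Lemma normc_conj z : normc z^* = normc z.
Proof. by case: z => x y /=; rewrite sqrrN. Qed.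

Lemma normc_exp z n : normc (z ^+ n) = normc z ^+ n.
Proof. by elim: n => [|n IH]; rewrite ?expr0 ?normc_one// !exprS normcM IH. Qed.

Lemma normc_triangle z w : normc (z + w) <= normc z + normc w.
Proof. exact: complex.le_normcD. Qed.

Lemma normc_opp z : normc (- z) = normc z.
Proof. exact: complex.normcN. Qed.

Lemma normc_distC z w : normc (z - w) = normc (w - z).
Proof. by rewrite -opprB normc_opp. Qed.

Lemma normc_triangleB z w : normc (z - w) <= normc z + normc w.
Proof. by rewrite -[normc w]normc_opp normc_triangle. Qed.

Lemma normc_triangle_dist z w : normc z <= normc w + normc (z - w).
Proof. by rewrite -{1}(subrK w z) addrC normc_triangle. Qed.

Lemma normc_sum (I : Type) (r : seq I) (P : pred I) (F : I -> R[i]) :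
  normc (\sum_(i <- r | P i) F i) <= \sum_(i <- r | P i) normc (F i).
Proof.
elim/big_ind2 : _ => //; first by rewrite normc_zero.
by move=> z x w y zx wy; rewrite (le_trans (normc_triangle _ _))// lerD.
Qed.

Lemma sqr_normcE z : normc z ^+ 2 = Re z ^+ 2 + Im z ^+ 2.
Proof. by case: z => x y /=; rewrite sqr_sqrtr// addr_ge0// sqr_ge0. Qed.

Lemma normc_eq0 z : (normc z == 0) = (z == 0).
Proof. by apply/eqP/eqP => [/eq0_normc//|->]; exact: normc_zero. Qed.

Lemma dist0_normc z : `|0 - normc z| = normc z.
Proof. by rewrite sub0r normrN ger0_norm ?normc_ge0. Qed.

Lemma normRe_le z : `|Re z| <= normc z.
Proof.
rewrite -(ler_pXn2r (ltn0Sn 1)) ?nnegrE ?normc_ge0// real_normK ?num_real//.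
by rewrite sqr_normcE lerDl sqr_ge0.
Qed.

Lemma normIm_le z : `|Im z| <= normc z.
Proof.
rewrite -(ler_pXn2r (ltn0Sn 1)) ?nnegrE ?normc_ge0// real_normK ?num_real//.
by rewrite sqr_normcE lerDr sqr_ge0.
Qed.

Lemma normc_le_ReIm z : normc z <= `|Re z| + `|Im z|.
Proof.
rewrite -(ler_pXn2r (ltn0Sn 1)) ?nnegrE ?normc_ge0 ?addr_ge0// sqr_normcE.
rewrite sqrrD !real_normK ?num_real// -addrA lerD2l lerDr.
by rewrite mulrn_wge0// mulr_ge0.
Qed.

Lemma ReD z w : Re (z + w) = Re z + Re w.
Proof. by case: z w => ? ? []. Qed.

Lemma ImD z w : Im (z + w) = Im z + Im w.
Proof. by case: z w => ? ? []. Qed.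

Lemma ReN z : Re (- z) = - Re z.
Proof. by case: z. Qed.

Lemma ImN z : Im (- z) = - Im z.
Proof. by case: z. Qed.

Lemma ReM z w : Re (z * w) = Re z * Re w - Im z * Im w.
Proof. by case: z w => ? ? []. Qed.

Lemma ImM z w : Im (z * w) = Re z * Im w + Im z * Re w.
Proof. by case: z w => ? ? []. Qed.

Lemma Re_sum (I : Type) (r : seq I) (P : pred I) (F : I -> R[i]) :
  Re (\sum_(i <- r | P i) F i) = \sum_(i <- r | P i) Re (F i).
Proof. exact: (big_morph _ ReD). Qed.

Lemma Im_sum (I : Type) (r : seq I) (P : pred I) (F : I -> R[i]) :
  Im (\sum_(i <- r | P i) F i) = \sum_(i <- r | P i) Im (F i).
Proof. exact: (big_morph _ ImD). Qed.

Lemma mulc_conj z : z * z^* = (normc z ^+ 2)%:C.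
Proof.
rewrite sqr_normcE; case: z => x y /=; apply/eqP; rewrite eq_complex /=.
by apply/andP; split; apply/eqP; ring.
Qed.

Lemma one_sub_conjM_neq0 a z : normc a < 1 -> normc z <= 1 -> 1 - a^* * z != 0.
Proof.
move=> a1 z1; rewrite subr_eq0; apply/negP => /eqP /(congr1 (@normc R)).
rewrite normc_one normcM normc_conj => e.
have : normc a * normc z <= normc a by rewrite ler_piMr// normc_ge0.
by rewrite -e leNgt a1.
Qed.

Lemma cvg_sum_ord (K : numFieldType) (V : normedModType K) (T : Type)
    (F : set_system T) {FF : Filter F} n (f : nat -> T -> V) (l : nat -> V) :
  (forall i, f i @ F --> l i) ->
  (fun t => \sum_(i < n) f i t) @ F --> \sum_(i < n) l i.
Proof.
move=> fl; elim: n => [|n IH].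
  rewrite big_ord0 (_ : (fun _ => _) = fun=> 0); first exact: cvg_cst.
  by apply/funext => t; rewrite big_ord0.
rewrite big_ord_recr (_ : (fun _ => _) = fun t => \sum_(i < n) f i t + f n t).
  by apply: cvgD; [exact: IH|exact: fl].
by apply/funext => t; rewrite big_ord_recr.
Qed.

Lemma cvg_sqr (T : Type) (F : set_system T) {FF : Filter F} (f : T -> R) x :
  f @ F --> x -> f t ^+ 2 @[t --> F] --> x ^+ 2.
Proof. by move=> fx; under eq_fun do rewrite expr2; rewrite expr2; exact: cvgM. Qed.

(** * Limits in the complex field, reduced to real limits *)

Section limits.
Context {T : Type} {F : set_system T} {FF : ProperFilter F}.
Implicit Types f : T -> R[i].

Lemma cvgC_normP f z :
  f @ F --> z <-> (fun t => normc (f t - z)) @ F --> (0 : R).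
Proof.
split=> /cvgrPdist_lt fz; apply/cvgrPdist_lt => e e0.
  have := fz e%:C; rewrite ltcR => /(_ e0); apply: filterS => t.
  by rewrite norm_normc ltcR sub0r normrN ger0_norm ?normc_ge0// normc_distC.
(* A positive element of [R[i]] is real, so the complex radius [e] can be traded for [Re e]. *)
have eE : e = (Re e)%:C.
  by move: e0; rewrite ltcE; case: (e) => ? ? /= /andP[/eqP ->].
have e0' : 0 < Re e by move: e0; rewrite ltcE => /andP[].
have := fz _ e0'; apply: filterS => t; rewrite norm_normc {2}eE ltcR.
by rewrite sub0r normrN ger0_norm ?normc_ge0// normc_distC.
Qed.

Lemma cvgC_lim f z : f @ F --> z -> lim (f @ F) = z.
Proof. by move=> fz; apply: cvg_lim => //; exact: (@norm_hausdorff _ R[i]). Qed.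

Lemma cvgC_squeeze f z (g : T -> R) :
  (\forall t \near F, normc (f t - z) <= g t) -> g @ F --> (0 : R) -> f @ F --> z.
Proof.
move=> fg g0; apply/cvgC_normP; apply: (@squeeze_cvgr _ _ _ _ (cst 0) g) => //.
- by apply: filterS fg => t /= ->; rewrite normc_ge0.
- exact: cvg_cst.
Qed.

Lemma cvg0_normcP f : normc (f t) @[t --> F] --> (0 : R) <->
  forall e : R, 0 < e -> \forall t \near F, normc (f t) < e.
Proof.
split=> [/cvgrPdist_lt f0 e e0|f0].
  by have := f0 _ e0; apply: filterS => t; rewrite dist0_normc.
apply/cvgrPdist_lt => e e0.
by have := f0 _ e0; apply: filterS => t; rewrite dist0_normc.
Qed.

Lemma cvgC_ReIm f z :
  Re (f t) @[t --> F] --> Re z -> Im (f t) @[t --> F] --> Im z -> f @ F --> z.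
Proof.
move=> /cvgrPdist_lt fR /cvgrPdist_lt fI; apply/cvgC_normP/cvgrPdist_lt => e e0.
have e20 : 0 < e / 2 by rewrite divr_gt0.
near=> t; rewrite sub0r normrN ger0_norm ?normc_ge0//.
apply: (le_lt_trans (normc_le_ReIm _)); rewrite ReD ImD ReN ImN (splitr e).
by rewrite ltrD// distrC; near: t; [exact: fR|exact: fI].
Unshelve. all: by end_near. Qed.

Lemma cvgC_norm f z : f @ F --> z -> normc (f t) @[t --> F] --> normc z.
Proof.
move=> /cvgC_normP/cvgrPdist_lt fz; apply/cvgrPdist_lt => e e0.
have := fz _ e0; apply: filterS => t; rewrite sub0r normrN => /(le_lt_trans (ler_norm _)).
apply: le_lt_trans; rewrite ler_norml; apply/andP; split.
  by rewrite lerBrDr addrC lerBlDr normc_triangle_dist.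
by rewrite lerBlDl normc_distC normc_triangle_dist.
Qed.

Lemma cvgC_Re f z : f @ F --> z -> Re (f t) @[t --> F] --> Re z.
Proof.
move=> /cvgC_normP/cvgrPdist_lt fz; apply/cvgrPdist_lt => e e0.
have := fz _ e0; apply: filterS => t; rewrite sub0r normrN => /(le_lt_trans (ler_norm _)).
by apply: le_lt_trans; rewrite distrC -ReN -ReD normRe_le.
Qed.

Lemma cvgC_Im f z : f @ F --> z -> Im (f t) @[t --> F] --> Im z.
Proof.
move=> /cvgC_normP/cvgrPdist_lt fz; apply/cvgrPdist_lt => e e0.
have := fz _ e0; apply: filterS => t; rewrite sub0r normrN => /(le_lt_trans (ler_norm _)).
by apply: le_lt_trans; rewrite distrC -ImN -ImD normIm_le.
Qed.

End limits.
End complex_basics.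

(** * Power series with bounded coefficients on the disc *)

Section power_series.
Context {R : realType}.
Implicit Types (c d u v W : nat -> R[i]) (a z s : R[i]) (M : R).

Definition bounded_coef c M := forall l, normc (c l) <= M.

Definition pser c z : R[i] := limn (series (fun l => c l * z ^+ l)).

Lemma pser_cvg c M z : bounded_coef c M -> normc z < 1 ->
  series (fun l => c l * z ^+ l) @ \oo --> pser c z.
Proof.
move=> cM z1.
have gc : cvgn (series (geometric M (normc z))).
  by apply: is_cvg_geometric_series; rewrite ger0_norm ?normc_ge0.
have M0 : 0 <= M := le_trans (normc_ge0 _) (cM 0%N).
have key (p : R[i] -> R) : (forall w, `|p w| <= normc w) ->
    cvgn (series (fun l => p (c l * z ^+ l))).
  move=> pn; apply: normed_cvg; apply: series_le_cvg gc => [n|n|n] /=; first exact: normr_ge0.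
    by rewrite mulr_ge0// exprn_ge0// normc_ge0.
  rewrite (le_trans (pn _))// normcM normc_exp ler_wpM2r//.
  by rewrite exprn_ge0// normc_ge0.
apply/cvg_ex; exists (limn (series (fun l => Re (c l * z ^+ l))) +i*
  limn (series (fun l => Im (c l * z ^+ l)))).
apply: cvgC_ReIm => /=.
  under eq_fun do rewrite /series/= Re_sum.
  by apply: key => w; exact: normRe_le.
under eq_fun do rewrite /series/= Im_sum.
by apply: key => w; exact: normIm_le.
Qed.

Lemma pserE c z w : series (fun l => c l * z ^+ l) @ \oo --> w -> pser c z = w.
Proof. exact: cvgC_lim. Qed.

Lemma normc_pser_le c M z : bounded_coef c M -> normc z < 1 ->
  normc (pser c z) <= M / (1 - normc z).
Proof.
move=> cM z1.
have M0 : 0 <= M := le_trans (normc_ge0 _) (cM 0%N).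
have gc : series (geometric M (normc z)) @ \oo --> M / (1 - normc z).
  by apply: cvg_geometric_series; rewrite ger0_norm ?normc_ge0.
apply: (ler_cvg_to (cvgC_norm (pser_cvg cM z1)) gc).
apply: nearW => n; rewrite /series/= (le_trans (normc_sum _ _ _))//.
apply: ler_sum => l _; rewrite normcM normc_exp ler_wpM2r//.
by rewrite exprn_ge0// normc_ge0.
Qed.

Lemma pser_comb c d M M' s t z : bounded_coef c M -> bounded_coef d M' ->
  normc z < 1 ->
  pser (fun l => s * c l + t * d l) z = s * pser c z + t * pser d z.
Proof.
move=> cM dM z1; apply: pserE.
rewrite (_ : series _ = fun n => s * series (fun l => c l * z ^+ l) n +
    t * series (fun l => d l * z ^+ l) n); last first.
  apply/funext => n; rewrite /series/= !mulr_sumr -big_split/=.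
  by apply: eq_bigr => l _; ring.
by apply: cvgD; (apply: cvgM; first exact: cvg_cst); apply: pser_cvg; eassumption.
Qed.

Lemma pser_shift c M z : bounded_coef c M -> normc z < 1 ->
  pser c z = c 0%N + z * pser (fun l => c l.+1) z.
Proof.
move=> cM z1; apply: pserE; rewrite -(cvg_shiftS (series _)).
have cM1 : bounded_coef (fun l => c l.+1) M by move=> l; exact: cM.
rewrite (_ : (fun n => _) = fun n => c 0%N + z *
    series (fun l => c l.+1 * z ^+ l) n); last first.
  apply/funext => n; rewrite /series/= big_nat_recl// expr0 mulr1; congr (_ + _).
  by rewrite mulr_sumr; apply: eq_bigr => l _; rewrite exprS; ring.
apply: cvgD; first exact: cvg_cst.
by apply: cvgM; [exact: cvg_cst|apply: pser_cvg; eassumption].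
Qed.

(* The coefficients of [(pser c z - pser c a) / (z - a)], shifted by one. *)
Lemma pser_tail_rec c M a : bounded_coef c M -> normc a < 1 ->
  exists W, [/\ forall l, W l = c l + a * W l.+1, W 0%N = pser c a
    & forall m l, (forall j, normc (c (l + j)%N) <= m) ->
        normc (W l) <= m / (1 - normc a)].
Proof.
move=> cM a1; have cM' l : bounded_coef (fun j => c (l + j)%N) M by move=> j; exact: cM.
exists (fun l => pser (fun j => c (l + j)%N) a); split=> //.
- move=> l; apply: (eq_trans (pser_shift (cM' l) a1)).
  rewrite addn0; suff -> : (fun j => c (l + j.+1)%N) = fun j => c (l.+1 + j)%N by [].
  by apply/funext => j; rewrite addnS addSn.
- by move=> m l cm; exact: normc_pser_le.
Qed.

(** Since [pser W z = W 0 + z * V], with [V] the series of the shifted [W], subtracting [a * V]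
    leaves the factor [z - a]. *)
Lemma pser_rec c W M a z : bounded_coef W M -> normc a < 1 -> normc z < 1 ->
  (forall l, W l = c l + a * W l.+1) ->
  pser c z = W 0%N + (z - a) * pser (fun l => W l.+1) z.
Proof.
move=> WM a1 z1 Wc; have W1 : bounded_coef (fun l => W l.+1) M by move=> l; exact: WM.
rewrite (_ : c = fun l => 1 * W l + (- a) * W l.+1); last first.
  by apply/funext => l; rewrite {1}Wc; ring.
by rewrite (pser_comb _ _ WM W1)// {1}(pser_shift WM)//; ring.
Qed.

(** The difference quotient at [a] is again a power series with bounded coefficients, hence bounded
    for [|z - a| < r]; the choice [r = (1 - |a|) / 2] keeps such [z] at distance at least [r] from
    the circle. *)
Lemma pser_continuous c M a : bounded_coef c M -> normc a < 1 ->
  pser c z @[z --> a] --> pser c a.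
Proof.
move=> cM a1; have [W [Wc W0 Wm]] := pser_tail_rec cM a1.
have Wb : bounded_coef W (M / (1 - normc a)) by move=> l; apply: Wm => j; exact: cM.
have W1b : bounded_coef (fun l => W l.+1) (M / (1 - normc a)) by move=> l; exact: Wb.
pose r := (1 - normc a) / 2.
have r0 : 0 < r by rewrite divr_gt0// subr_gt0.
have M0 : 0 <= M / (1 - normc a) := le_trans (normc_ge0 _) (Wb 0%N).
have ida : id @ a --> a by exact: cvg_id.
have /cvgC_normP/cvgrPdist_lt za := ida.
have FF : ProperFilter (nbhs a) := nbhs_pfilter a.
apply: (@cvgC_squeeze _ _ _ FF _ _ (fun z => normc (z - a) * (M / (1 - normc a) / r))).
  near=> z.
  have zar : normc (z - a) < r.
    have : `|0 - normc (z - a)| < r by near: z; exact: za.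
    by rewrite sub0r normrN ger0_norm ?normc_ge0.
  have z1 : normc z < 1 - r.
    rewrite (le_lt_trans (normc_triangle_dist z a))//.
    by move: zar; rewrite /r; lra.
  have z1' : normc z < 1 by rewrite (lt_le_trans z1)// lerBlDr lerDl ltW.
  rewrite (pser_rec Wb a1 z1' Wc) W0 addrC addKr normcM ler_wpM2l ?normc_ge0//.
  rewrite (le_trans (normc_pser_le W1b z1'))// ler_wpM2l// lef_pV2 ?posrE//; lra.
rewrite -[X in _ --> X](mul0r (M / (1 - normc a) / r)).
by apply: cvgM; [exact/cvgC_normP|exact: cvg_cst].
Unshelve. all: by end_near. Qed.

End power_series.

Opaque pser.

(** * Square-summable coefficient sequences *)

Section square_summable.
Context {R : realType}.
Implicit Types (c d u v W : nat -> R[i]) (a z : R[i]) (s M : R).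

Definition is_nsq c s := series (fun l => normc (c l) ^+ 2) @ \oo --> s.

Lemma series_nsq_le c s n : is_nsq c s -> series (fun l => normc (c l) ^+ 2) n <= s.
Proof.
move=> cs; have <- : limn (series (fun l => normc (c l) ^+ 2)) = s.
  by apply: cvg_lim cs; exact: Rhausdorff.
apply: nondecreasing_cvgn_le; last by apply/cvg_ex; exists s.
by apply: nondecreasing_series => l _ _; exact: sqr_ge0.
Qed.

Lemma nsq_ge0 c s : is_nsq c s -> 0 <= s.
Proof. by move=> /(series_nsq_le 0); rewrite /series/= big_geq. Qed.

Lemma nsq_bounded c s : is_nsq c s -> bounded_coef c (Num.sqrt s).
Proof.
move=> cs l; rewrite -(ler_pXn2r (ltn0Sn 1)) ?nnegrE ?normc_ge0 ?sqrtr_ge0//.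
rewrite sqr_sqrtr ?(nsq_ge0 cs)//; apply: le_trans (series_nsq_le l.+1 cs).
rewrite seriesSr lerDr /series/= sumr_ge0// => k _; exact: sqr_ge0.
Qed.

Lemma nsq_coef_cvg0 c s : is_nsq c s -> normc (c l) @[l --> \oo] --> (0 : R).
Proof.
move=> cs; have h : (fun l => normc (c l) ^+ 2) @ \oo --> (0 : R).
  by apply: cvg_series_cvg_0; apply/cvg_ex; exists s.
have : Num.sqrt (normc (c l) ^+ 2) @[l --> \oo] --> Num.sqrt (0 : R).
  by apply: continuous_cvg h; exact: sqrt_continuous.
by rewrite sqrtr0; under eq_fun do rewrite sqrtr_sqr ger0_norm ?normc_ge0//.
Qed.

Lemma nsq_of_bound c M : (forall n, series (fun l => normc (c l) ^+ 2) n <= M) ->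
  exists s, is_nsq c s.
Proof.
move=> cM; suff : cvgn (series (fun l => normc (c l) ^+ 2)) by move=> /cvg_ex.
apply: nondecreasing_is_cvgn.
  by apply: nondecreasing_series => l _ _; exact: sqr_ge0.
by exists M => _ [n _ <-].
Qed.

Lemma hardy2_nsq (f : R[i] -> R[i]) : hardy2 f <->
  exists c s, is_nsq c s /\ forall z, unit_disc z -> f z = pser c z.
Proof.
split=> [[c [coo fc]]|[c [s [cs fc]]]].
  exists c; have [|s cs] := @nsq_of_bound c (fine (\sum_(0 <= l <oo) ((normc (c l)) ^+ 2)%:E)%E).
    move=> n; rewrite -lee_fin fineK; last first.
      by rewrite ge0_fin_numE// nneseries_ge0// => k _ _; rewrite lee_fin sqr_ge0.
    rewrite /series/= -sumEFin; apply: nneseries_lim_ge => k _ _.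
    by rewrite lee_fin sqr_ge0.
  by exists s; split=> // z /fc/pserE ->.
exists c; split; last first.
  move=> z zD; rewrite (fc _ zD); exact: pser_cvg (nsq_bounded cs) zD.
apply: (@le_lt_trans _ _ s%:E); last exact: ltry.
apply: lime_le.
  by apply: is_cvg_nneseries => k _ _; rewrite lee_fin sqr_ge0.
apply: nearW => n; rewrite sumEFin lee_fin; exact: series_nsq_le cs.
Qed.

Lemma cvg_rec0 (x e : nat -> R) b : 0 <= b < 1 -> (forall l, 0 <= x l) ->
  (forall l, x l.+1 <= b * x l + e l) -> e @ \oo --> (0 : R) -> x @ \oo --> (0 : R).
Proof.
move=> /andP[b0 b1] x0 xe /cvgrPdist_lt e0; apply/cvgrPdist_lt => d d0.
have b10 : 0 < 1 - b by rewrite subr_gt0.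
(* The threshold makes [d / 2] the fixed point of [x |-> b * x + (1 - b) * (d / 2)], so the excess
   over [d / 2] shrinks by the factor [b] at each step. *)
have [N _ HN] : \forall l \near \oo, `|0 - e l| < (1 - b) * (d / 2).
  by apply: e0; rewrite mulr_gt0// divr_gt0.
have key j : x (N + j)%N <= b ^+ j * x N + d / 2.
  elim: j => [|j IH]; first by rewrite addn0 expr0 mul1r lerDl ltW// divr_gt0.
  rewrite addnS (le_trans (xe _))//.
  have := HN (N + j)%N (leq_addr _ _); rewrite sub0r normrN => /(le_lt_trans (ler_norm _)) ej.
  have := ler_wpM2l b0 IH; rewrite exprS; lra.
have /cvgrPdist_lt bj : (fun j => b ^+ j * x N) @ \oo --> (0 : R).
  rewrite -[X in _ --> X](mul0r (x N)); apply: cvgM; last exact: cvg_cst.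
  by apply: cvg_expr; rewrite ger0_norm.
have [K _ HK] := bj (d / 2) (divr_gt0 d0 (ltr0n _ 2)).
exists (N + K)%N => // l /= NKl.
have Nl : (N <= l)%N by rewrite (leq_trans _ NKl)// leq_addr.
rewrite sub0r normrN ger0_norm// -(subnKC Nl) (le_lt_trans (key _))//.
have := HK (l - N)%N; rewrite /= leq_subRL// => /(_ NKl).
by rewrite sub0r normrN => /(le_lt_trans (ler_norm _)); lra.
Qed.

(* The telescoping form of: multiplication by [blaschke a] is isometric and its
   range is orthogonal to [szego a]. *)
Lemma nsq_pythagoras_partial (a sg : R[i]) (k : R) W n :
  k ^+ 2 = 1 - normc a ^+ 2 -> W 0%N = 0 ->
  series (fun l => normc (sg * k%:C * (a ^+ l)^* + W l - a * W l.+1) ^+ 2) n =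
  normc sg ^+ 2 * (1 - normc (a ^+ n) ^+ 2)
  + series (fun l => normc (W l.+1 - a^* * W l) ^+ 2) n
  - (1 - normc a ^+ 2) * normc (W n) ^+ 2
  - 2 * k * Re (sg^* * a ^+ n * W n).
Proof.
move=> k2 W0; elim: n => [|n IH].
  rewrite expr0 normc_one W0 normc_zero mulr0 /series/= !big_geq//; ring.
rewrite !seriesSr IH (exprS a n); move: k2.
move: (a ^+ n) (W n) (W n.+1) => e w w1; rewrite (normcM a e) exprMn.
move: (series _ n) => S; rewrite !sqr_normcE.
case: a e w w1 sg {IH} => [ax ay] [ex ey] [wx wy] [vx vy] [sx sy] /= k2.
rewrite !(expr0n, mul0r, mulr0, subr0, addr0, add0r).
have -> : ax ^+ 2 + ay ^+ 2 = 1 - k ^+ 2 by rewrite k2; ring.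
(* In real coordinates the identity is polynomial modulo [k ^+ 2 = 1 - |a|^2], which [ring] receives
   as a rule for [ax ^+ 2]. *)
have a2 : ax ^+ 2 = 1 - k ^+ 2 - ay ^+ 2 by rewrite k2; ring.
ring: a2.
Qed.

End square_summable.

(** * One-step decomposition along a Szego kernel *)

Section szego_decomposition.
Context {R : realType}.
Implicit Types (c d u v W : nat -> R[i]) (a z sg : R[i]) (s M : R).

Local Notation kap a := (Num.sqrt (1 - normc a ^+ 2)).

Lemma sqr_kap a : normc a < 1 -> kap a ^+ 2 = 1 - normc a ^+ 2.
Proof. by move=> a1; rewrite sqr_sqrtr// subr_ge0 exprn_ile1 ?normc_ge0// ltW. Qed.

(** Here [W] stands for [z V(z)], whence the condition [W 0 = 0] below: the series is
    [sg * szego a + (z - a) V], and [minus_coef a W] belongs to [(1 - a^* z) V]. The index shift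
    expresses both without naming [V]. *)
Definition plus_coef a sg W l : R[i] :=
  sg * (kap a)%:C * (a ^+ l)^* + W l - a * W l.+1.

Definition minus_coef a W l : R[i] := W l.+1 - a^* * W l.

Lemma cvg_normc_exp a : normc a < 1 -> normc (a ^+ n) @[n --> \oo] --> (0 : R).
Proof.
move=> a1; under eq_fun do rewrite normc_exp.
by apply: cvg_expr; rewrite ger0_norm ?normc_ge0.
Qed.

(** These are the boundary terms of the telescoped sum; each carries a factor [a ^+ n] or [W n]. *)
Lemma nsq_pythagoras_err a sg W : normc a < 1 ->
  normc (W n) @[n --> \oo] --> (0 : R) ->
  (fun n => - (normc sg ^+ 2 * normc (a ^+ n) ^+ 2) - (1 - normc a ^+ 2) * normc (W n) ^+ 2
     - 2 * kap a * Re (sg^* * a ^+ n * W n)) @ \oo --> (0 : R).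
Proof.
move=> a1 W0; have an0 := cvg_normc_exp a1.
rewrite (_ : 0 = - (normc sg ^+ 2 * 0 ^+ 2) - (1 - normc a ^+ 2) * 0 ^+ 2
  - 2 * kap a * 0 :> R); last by ring.
have sq (x : nat -> R) : x @ \oo --> (0 : R) -> x n ^+ 2 @[n --> \oo] --> (0 ^+ 2 : R).
  by move=> x0; under eq_fun do rewrite expr2; rewrite expr2; exact: cvgM.
apply: cvgB; first apply: cvgB.
- by apply: cvgN; apply: cvgM; [exact: cvg_cst|exact: sq].
- by apply: cvgM; [exact: cvg_cst|exact: sq].
- apply: cvgM; first exact: cvg_cst.
  apply: (@cvgC_Re _ _ _ _ _ 0); apply/cvgC_normP.
  under eq_fun do rewrite subr0 !normcM normc_conj.
  rewrite (_ : 0 = normc sg * 0 * 0 :> R); last by ring.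
  by apply: cvgM => //; apply: cvgM => //; exact: cvg_cst.
Qed.

(** Both directions serve: backwards to pass from a function to its reduction, forwards to rebuild a
    residual by multiplication with a Blaschke factor. *)
Lemma nsq_plus_minus a sg W s : normc a < 1 -> W 0%N = 0 ->
  normc (W n) @[n --> \oo] --> (0 : R) ->
  is_nsq (minus_coef a W) s <-> is_nsq (plus_coef a sg W) (normc sg ^+ 2 + s).
Proof.
move=> a1 W0 Wc; have err := nsq_pythagoras_err sg a1 Wc.
have pE n := nsq_pythagoras_partial sg n (sqr_kap a1) W0.
split=> h; rewrite /is_nsq.
  rewrite (_ : series _ = fun n => normc sg ^+ 2 +
    series (fun l => normc (minus_coef a W l) ^+ 2) n +
    (- (normc sg ^+ 2 * normc (a ^+ n) ^+ 2) - (1 - normc a ^+ 2) * normc (W n) ^+ 2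
     - 2 * kap a * Re (sg^* * a ^+ n * W n))); last first.
    by apply/funext => n; rewrite [LHS]pE /minus_coef; ring.
  rewrite -[X in _ --> X]addr0; apply: cvgD => //.
  by apply: cvgD => //; exact: cvg_cst.
rewrite (_ : series _ = fun n => series (fun l => normc (plus_coef a sg W l) ^+ 2) n -
    normc sg ^+ 2 -
    (- (normc sg ^+ 2 * normc (a ^+ n) ^+ 2) - (1 - normc a ^+ 2) * normc (W n) ^+ 2
     - 2 * kap a * Re (sg^* * a ^+ n * W n))); last first.
  apply/funext => n; rewrite [X in _ = X - _ - _]pE /minus_coef; ring.
rewrite (_ : s = normc sg ^+ 2 + s - normc sg ^+ 2 - 0); last by ring.
apply: cvgB => //; apply: cvgB => //; exact: cvg_cst.
Qed.

Lemma nsq_minus_of_plus a sg W s : normc a < 1 -> W 0%N = 0 ->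
  normc (W n) @[n --> \oo] --> (0 : R) ->
  is_nsq (plus_coef a sg W) s -> is_nsq (minus_coef a W) (s - normc sg ^+ 2).
Proof.
move=> a1 W0 Wc h; apply/(nsq_plus_minus sg _ a1 W0 Wc).
by rewrite addrC subrK.
Qed.

Lemma pserZ c M t z : bounded_coef c M -> normc z < 1 ->
  pser (fun l => t * c l) z = t * pser c z.
Proof.
move=> cM z1; have := pser_comb t 0 cM cM z1; rewrite mul0r addr0 => <-.
by congr pser; apply/funext => l; rewrite mul0r addr0.
Qed.

Lemma bounded_szego a M : normc a < 1 -> kap a <= M ->
  bounded_coef (fun l => (kap a)%:C * (a ^+ l)^*) M.
Proof.
move=> a1 kM l; rewrite normcM normc_conj normc_exp normc_real ger0_norm ?sqrtr_ge0//.
by rewrite (le_trans _ kM)// ler_piMr ?sqrtr_ge0// exprn_ile1 ?normc_ge0// ltW.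
Qed.

Lemma pser_szego a z : normc a < 1 -> normc z < 1 ->
  pser (fun l => (kap a)%:C * (a ^+ l)^*) z = szego a z.
Proof.
move=> a1 z1; have b := bounded_szego a1 (lexx _).
set c := fun l => _ in b *.
have c0 : c 0%N = (kap a)%:C by rewrite /c expr0 rmorph1 mulr1.
(* Shifting the geometric series by one index yields an equation for its own sum, solved below by
   dividing by [1 - a^* * z]. *)
have E : pser c z = (kap a)%:C + z * (a^* * pser c z).
  rewrite {1}(pser_shift b z1) c0; congr (_ + _ * _).
  rewrite -(pserZ _ b z1); congr pser; apply/funext => l.
  by rewrite /c (exprS a l) rmorphM/=; ring.
rewrite /szego; have nz := one_sub_conjM_neq0 a1 (ltW z1).
apply: (mulIf nz); rewrite divfK// mulrBr mulr1 {1}E; ring.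
Qed.

Lemma bounded_of_cvg0 W : normc (W n) @[n --> \oo] --> (0 : R) ->
  exists M, bounded_coef W M.
Proof.
move=> W0.
have [M [_ HM]] : bounded_fun (fun n => normc (W n)).
  by apply: cvg_seq_bounded; apply/cvg_ex; exists (0 : R).
exists (M + 1) => l; have := HM (M + 1); rewrite ltrDl ltr01 => /(_ isT) /(_ l).
by move=> /(_ I) /=; rewrite ger0_norm ?normc_ge0.
Qed.

Lemma pser_plus_coef a sg W z : normc a < 1 -> W 0%N = 0 ->
  normc (W n) @[n --> \oo] --> (0 : R) -> normc z < 1 ->
  pser (plus_coef a sg W) z = sg * szego a z + blaschke a z * pser (minus_coef a W) z.
Proof.
move=> a1 W0 Wc z1; have [M WM] := bounded_of_cvg0 Wc.
have WM1 : bounded_coef (fun l => W l.+1) M by move=> l; exact: WM.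
have eb := bounded_szego a1 (lexx _).
have nz := one_sub_conjM_neq0 a1 (ltW z1).
have Wz : pser W z = z * pser (fun l => W l.+1) z.
  by rewrite (pser_shift WM z1) W0 add0r.
have mE : pser (minus_coef a W) z = (1 - a^* * z) * pser (fun l => W l.+1) z.
  rewrite (_ : minus_coef a W = fun l => 1 * W l.+1 + (- a^*) * W l); last first.
    by apply/funext => l; rewrite /minus_coef; ring.
  by rewrite (pser_comb _ _ WM1 WM z1) Wz; ring.
have dM : bounded_coef (fun l => 1 * W l + (- a) * W l.+1) (M + normc a * M).
  move=> l; rewrite (le_trans (normc_triangle _ _))// mul1r normcM normc_opp.
  by rewrite lerD// ler_wpM2l ?normc_ge0.
rewrite (_ : plus_coef a sg W = fun l => sg * ((kap a)%:C * (a ^+ l)^*) +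
    1 * (1 * W l + (- a) * W l.+1)); last first.
  by apply/funext => l; rewrite /plus_coef; ring.
rewrite (pser_comb _ _ eb dM z1) pser_szego// (pser_comb _ _ WM WM1 z1) Wz mE.
rewrite /blaschke; congr (_ + _); rewrite [RHS]mulrA divfK//; ring.
Qed.

(* Solves [c = plus_coef a sg W]; the choice of [sg] makes [c - sg * szego]
   vanish at [a]. *)
Lemma plus_coef_split c s a : is_nsq c s -> normc a < 1 ->
  exists W, [/\ W 0%N = 0, normc (W n) @[n --> \oo] --> (0 : R)
    & c = plus_coef a ((kap a)%:C * pser c a) W].
Proof.
move=> cs a1; set sg := _ * pser c a.
have cM := nsq_bounded cs; have eb := bounded_szego a1 (lexx _).
pose g l := 1 * c l + (- sg) * ((kap a)%:C * (a ^+ l)^*).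
have gM : bounded_coef g (Num.sqrt s + normc sg * kap a).
  move=> l; rewrite (le_trans (normc_triangle _ _))// mul1r normcM normc_opp.
  by rewrite lerD// ler_wpM2l ?normc_ge0//; exact: eb.
have g0 : normc (g n) @[n --> \oo] --> (0 : R).
  apply: (@squeeze_cvgr _ _ _ _ (cst 0)
    (fun n => normc (c n) + normc sg * (kap a * normc (a ^+ n)))).
  - apply: nearW => n /=; rewrite normc_ge0/= (le_trans (normc_triangle _ _))//.
    rewrite mul1r normcM normc_opp lerD2l ler_wpM2l ?normc_ge0// normcM normc_conj.
    by rewrite normc_real ger0_norm ?sqrtr_ge0.
  - exact: cvg_cst.
  - rewrite (_ : 0 = 0 + normc sg * (kap a * 0) :> R); last by ring.
    apply: cvgD; first exact: nsq_coef_cvg0 cs.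
    by apply: cvgM; [exact: cvg_cst|apply: cvgM; [exact: cvg_cst|exact: cvg_normc_exp]].
have [W [Wg W0 Wm]] := pser_tail_rec gM a1.
exists W; split.
(* [W 0] is the value at [a] of [c] minus its Szego part; it cancels because
   [kap a ^+ 2 = 1 - a^* * a]. *)
- rewrite W0 (pser_comb _ _ cM eb a1) pser_szego// /szego /sg.
  have n2 : 1 - a^* * a != 0 := one_sub_conjM_neq0 a1 (ltW a1).
  have e : (kap a)%:C * (kap a)%:C = 1 - a^* * a :> R[i].
    rewrite -rmorphM/= -expr2 sqr_kap// mulrC mulc_conj rmorphB/= rmorph1 //.
  move: n2 e; set D := 1 - _; set K := _%:C; move: (pser c a) => P n2 e.
  rewrite (_ : 1 * P + _ = P - K * K / D * P); last by ring.
  by rewrite e mulfV// mul1r subrr.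
(* [W l] is at most a bound of [g] from index [l] on, divided by [1 - |a|]; hence the threshold
   [e / 2 * (1 - |a|)]. *)
- move: g0 => /cvgrPdist_lt g0; apply/cvgrPdist_lt => e e0.
  have a10 : 0 < 1 - normc a by rewrite subr_gt0.
  have [N _ HN] := g0 (e / 2 * (1 - normc a)) (mulr_gt0 (divr_gt0 e0 (ltr0n _ 2)) a10).
  exists N => // l /= Nl; rewrite sub0r normrN ger0_norm ?normc_ge0//.
  apply: (@le_lt_trans _ _ (e / 2)); last lra.
  rewrite -(mulfK (lt0r_neq0 a10) (e / 2)); apply: Wm => j.
  have := HN (l + j)%N (leq_trans Nl (leq_addr _ _)).
  by rewrite sub0r normrN ger0_norm ?normc_ge0// => /ltW.
- apply/funext => l; rewrite /plus_coef {1}Wg /g; ring.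
Qed.

(** Dividing by [1 - a^* z] is a forward recursion with contraction factor [|a|], so [W] decays with
    [u]. Division by [z - a] would be expanding in that direction, which is why [plus_coef_split]
    sums tails instead. *)
Lemma minus_coef_split u a : normc a < 1 ->
  normc (u n) @[n --> \oo] --> (0 : R) ->
  exists W, [/\ W 0%N = 0, normc (W n) @[n --> \oo] --> (0 : R)
    & u = minus_coef a W].
Proof.
move=> a1 u0.
pose W := fix W n := if n is l.+1 then u l + a^* * W l else 0.
exists W; split=> //.
- apply: (@cvg_rec0 _ _ _ (normc a) _ _ _ u0) => [|l|l]; rewrite ?normc_ge0//.
  rewrite [W _]/= (le_trans (normc_triangle _ _))// normcM normc_conj.
  by rewrite addrC.
- by apply/funext => l; rewrite /minus_coef/= addrK.
Qed.

(** What remains of the squared norm after removing the Szego component is nonnegative: this is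
    [|<c, e_a>|^2 <= |c|^2] read on coefficients. *)
Lemma pser_sqr_le c s a : is_nsq c s -> normc a < 1 ->
  (1 - normc a ^+ 2) * normc (pser c a) ^+ 2 <= s.
Proof.
move=> cs a1; have [W [W0 Wc cE]] := plus_coef_split cs a1.
move: (cs); rewrite {1}cE => /(nsq_minus_of_plus a1 W0 Wc)/nsq_ge0.
by rewrite subr_ge0 normcM exprMn normc_real ger0_norm ?sqrtr_ge0// sqr_kap.
Qed.

Lemma blaschke_neq0 a z : normc a < 1 -> normc z < 1 -> z != a -> blaschke a z != 0.
Proof.
move=> a1 z1 za; rewrite mulf_neq0 ?invr_eq0 ?subr_eq0//.
by rewrite -subr_eq0 one_sub_conjM_neq0// ltW.
Qed.

(** The value of [h2dot f (szego a)] is assumed here, which separates this part from boundary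
    values; [h2dot_szego] supplies it later. At [z = a] the limit in [reduce] is found by continuity
    of the power series of the quotient. *)
Lemma reduce_pser (f : R[i] -> R[i]) c a W :
  (forall z, unit_disc z -> f z = pser c z) -> unit_disc a ->
  h2dot f (szego a) = (kap a)%:C * f a ->
  W 0%N = 0 -> normc (W n) @[n --> \oo] --> (0 : R) ->
  c = plus_coef a ((kap a)%:C * pser c a) W ->
  forall z, unit_disc z -> reduce f a z = pser (minus_coef a W) z.
Proof.
move=> fc a1 fa W0 Wc cE z z1; rewrite /reduce fa.
have qE w : unit_disc w -> w != a ->
    (f w - (kap a)%:C * f a * szego a w) / blaschke a w = pser (minus_coef a W) w.
  move=> w1 wa; rewrite (fc w w1) (fc a a1) {1}cE pser_plus_coef// addrC addKr.
  by rewrite mulrC mulKf// blaschke_neq0.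
case: (eqVneq z a) => [->|za]; last exact: qE.
have [M WM] := bounded_of_cvg0 Wc.
have mM : bounded_coef (minus_coef a W) (M + normc a * M).
  move=> l; rewrite (le_trans (normc_triangleB _ _))// normcM normc_conj.
  by rewrite lerD// ler_wpM2l ?normc_ge0.
have FF : ProperFilter a^' by exact: Proper_dnbhs_numFieldType.
have FN : ProperFilter (nbhs a) := nbhs_pfilter a.
apply: (@cvgC_lim _ _ _ FF).
have h : pser (minus_coef a W) w @[w --> a^'] --> pser (minus_coef a W) a.
  exact: cvg_within_filter (pser_continuous mM a1).
apply: cvg_trans h; apply: near_eq_cvg.
have /cvgC_normP/cvgrPdist_lt ida : id @ a --> a by exact: cvg_id.
have a10 : 0 < 1 - normc a by rewrite subr_gt0.
have := ida _ a10; rewrite /dnbhs /within /=; apply: filterS => w wa neq.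
rewrite qE//= /unit_disc/= (le_lt_trans (normc_triangle_dist w a))//.
by move: wa; rewrite sub0r normrN ger0_norm ?normc_ge0//; lra.
Qed.

End szego_decomposition.

(** * Tails of coefficient sequences *)

Section tails.
Context {R : realType}.
Implicit Types (c : nat -> R[i]) (z : R[i]) (s M : R).

Definition tail_coef N c l : R[i] := if (l < N)%N then 0 else c l.

Lemma series_tail_coef (V : zmodType) (F G : nat -> V) N n :
  (forall l, (l < N)%N -> G l = 0) -> (forall l, (N <= l)%N -> G l = F l) ->
  series G (n + N)%N = series F (n + N)%N - series F N.
Proof.
move=> G0 GF; elim: n => [|n IH].
  by rewrite add0n subrr /series/= big_nat big1// => l /andP[_ /G0].
by rewrite addSn !seriesSr IH GF ?leq_addl// addrAC.
Qed.

Lemma nsq_tail c s N : is_nsq c s ->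
  is_nsq (tail_coef N c) (s - series (fun l => normc (c l) ^+ 2) N).
Proof.
move=> cs; rewrite /is_nsq -(cvg_shiftn N).
rewrite (_ : (fun n => _) = fun n => series (fun l => normc (c l) ^+ 2) (n + N)%N -
    series (fun l => normc (c l) ^+ 2) N); last first.
  apply/funext => n; apply: series_tail_coef => l.
    by rewrite /tail_coef => ->; rewrite normc_zero expr0n.
  by rewrite /tail_coef ltnNge => ->.
apply: cvgB; last exact: cvg_cst.
by rewrite (cvg_shiftn N (series (fun l => normc (c l) ^+ 2))).
Qed.

Lemma pser_tail c M z N : bounded_coef c M -> normc z < 1 ->
  pser (tail_coef N c) z = pser c z - \sum_(l < N) c l * z ^+ l.
Proof.
move=> cM z1; apply: pserE; rewrite -(cvg_shiftn N).
rewrite (_ : (fun n => _) = fun n => series (fun l => c l * z ^+ l) (n + N)%N -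
    series (fun l => c l * z ^+ l) N); last first.
  apply/funext => n; apply: series_tail_coef => l.
    by rewrite /tail_coef => ->; rewrite mul0r.
  by rewrite /tail_coef ltnNge => ->.
rewrite -(big_mkord xpredT (fun l => c l * z ^+ l)).
apply: cvgB; last exact: cvg_cst.
by rewrite (cvg_shiftn N (series (fun l => c l * z ^+ l))); apply: pser_cvg z1.
Qed.

Lemma nsq_tail_lt c s e : is_nsq c s -> 0 < e ->
  exists N, s - series (fun l => normc (c l) ^+ 2) N < e.
Proof.
move=> cs e0; have /cvgrPdist_lt/(_ _ e0)[N _ /(_ N)] := cs.
by move=> /(_ (leqnn _)) /(le_lt_trans (ler_norm _)) h; exists N.
Qed.

End tails.

(** * Existence of a maximizing point *)

Section maximizer.
Context {R : realType}.
Implicit Types (c : nat -> R[i]) (z a b : R[i]) (s M r : R).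

Lemma sqr_normcD_le z w : normc (z + w) ^+ 2 <= 2 * normc z ^+ 2 + 2 * normc w ^+ 2 :> R.
Proof.
rewrite (le_trans (_ : _ <= (normc z + normc w) ^+ 2))//.
  by rewrite ler_pXn2r// ?nnegrE ?addr_ge0 ?normc_ge0// normc_triangle.
have := sqr_ge0 (normc z - normc w); lra.
Qed.

(** A polynomial head is bounded, hence killed by [1 - |b|^2], and [pser_sqr_le] controls the tail
    by its norm, uniformly in [b]. *)
Lemma pser_decay c s e : is_nsq c s -> 0 < e ->
  exists2 r : R, r < 1 & forall b, normc b < 1 -> r < normc b ->
    (1 - normc b ^+ 2) * normc (pser c b) ^+ 2 < e.
Proof.
move=> cs e0; have e4 : 0 < e / 4 by rewrite divr_gt0.
have [N sN] := nsq_tail_lt cs e4.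
pose H := \sum_(l < N) normc (c l).
have H0 : 0 <= H by apply: sumr_ge0 => l _; exact: normc_ge0.
(* From [1 - |b| < e / D] follows [(1 - |b|^2) * H^2 <= e / 4]; after the factor 2 of
   [sqr_normcD_le], head and tail cost at most [e / 2] each, the tail strictly less. *)
pose D := 8 * (H ^+ 2 + 1).
have D0 : 0 < D by rewrite mulr_gt0// ltr_wpDl ?sqr_ge0.
exists (1 - e / D) => [|b b1 br]; first by rewrite ltrBlDr ltrDl divr_gt0.
have b0 := normc_ge0 b.
have hd : normc (\sum_(l < N) c l * b ^+ l) <= H.
  rewrite (le_trans (normc_sum _ _ _))//; apply: ler_sum => l _.
  by rewrite normcM normc_exp ler_piMr ?normc_ge0// exprn_ile1// ltW.
have hd2 : normc (\sum_(l < N) c l * b ^+ l) ^+ 2 <= H ^+ 2.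
  by rewrite ler_pXn2r// ?nnegrE ?normc_ge0.
have tl := pser_sqr_le (@nsq_tail _ _ _ N cs) b1.
have := sqr_normcD_le (\sum_(l < N) c l * b ^+ l) (pser (tail_coef N c) b).
rewrite (@pser_tail _ _ _ b N (nsq_bounded cs) b1) addrC subrK -(@pser_tail _ _ _ b N (nsq_bounded cs) b1).
set x := normc (pser c b) ^+ 2; set y := normc (pser _ b) ^+ 2 in tl *.
set h := normc (\sum_(l < N) _) ^+ 2 in hd2 *; set B := normc b in b0 b1 br tl *.
move=> xhy; have q0 : 0 < 1 - B ^+ 2 by nra.
have q1 : (1 - B ^+ 2) * D <= 2 * e.
  have : (1 - B) * D < e by rewrite -ltr_pdivlMr//; lra.
  have : 0 <= (1 - B) * D by rewrite mulr_ge0 ?subr_ge0 ?ltW.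
  nra.
have h1 : (1 - B ^+ 2) * x <= (1 - B ^+ 2) * (2 * h + 2 * y) by rewrite ler_wpM2l// ltW.
have h2 : (1 - B ^+ 2) * h <= (1 - B ^+ 2) * H ^+ 2 by rewrite ler_wpM2l// ltW.
by move: q1; rewrite /D; lra.
Qed.

Lemma compact_disc_max (g : R[i] -> R) r : 0 <= r ->
  (forall z, normc z <= r -> g w @[w --> z] --> g z) ->
  exists2 b, normc b <= r & forall z, normc z <= r -> g z <= g b.
Proof.
move=> r0 gc.
pose toC (p : R * R) := p.1 +i* p.2.
have toC_cvg p : toC q @[q --> p] --> toC p.
  by apply: cvgC_ReIm => /=; [exact: cvg_fst|exact: cvg_snd].
pose A := (`[- r, r]%classic `*` `[- r, r]%classic) `&`
  ((fun p : R * R => normc (toC p)) @^-1` [set x | x <= r]).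
have cA : compact A.
  apply: compact_closedI.
    by apply: compact_setX; exact: segment_compact.
  apply: preimage_closed; last exact: closed_le.
  by move=> p _; exact: cvgC_norm (toC_cvg p).
have A0 : A !=set0.
  exists (0, 0); split; first by split=> /=; rewrite in_itv/= oppr_le0 r0.
  by apply: (le_trans _ r0); have -> : toC (0, 0) = 0 by []; rewrite normc_zero.
have gA : {within A, continuous (g \o toC)}.
  apply: continuous_in_subspaceT => p /set_mem[_ /= pr].
  by apply: (@cvg_comp _ _ _ toC g); [exact: toC_cvg|exact: gc].
have inA z : normc z <= r -> (Re z, Im z) \in A.
  move=> zr; apply/mem_set; split; last by case: z zr.
  by split=> /=; rewrite in_itv/= -ler_norml (le_trans _ zr)// ?normRe_le ?normIm_le.
have [p /set_mem[_ pr] pmax] := compact_EVT_max A0 cA gA.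
exists (toC p) => // z /inA/pmax; rewrite /=; by case: z.
Qed.

Lemma maximizer_exists (f : R[i] -> R[i]) c s : is_nsq c s ->
  (forall z, unit_disc z -> f z = pser c z) -> exists b, is_maximizer f b.
Proof.
move=> cs fc; pose g z := (1 - normc z ^+ 2) * normc (pser c z) ^+ 2.
have g0 z : normc z < 1 -> 0 <= g z.
  by move=> z1; rewrite mulr_ge0 ?sqr_ge0// subr_ge0 exprn_ile1 ?normc_ge0// ltW.
suff [b b1 bmax] : exists2 b, normc b < 1 & forall z, normc z < 1 -> g z <= g b.
  exists b; split; first exact: b1.
  by move=> z z1; rewrite (fc _ z1) (fc _ b1); exact: (bmax z z1).
(* If the objective vanishes on the disc, 0 maximizes it. Otherwise a positive value [g b0] serves
   as the decay level, and taking [t >= |b0|] makes the maximum over the disc of radius [t] at least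
   [g b0]. *)
have [[b0 b01 gb0]|gz] := pselect (exists2 b0, normc b0 < 1 & 0 < g b0); last first.
  exists 0; first by rewrite normc_zero.
  move=> z z1; apply: (@le_trans _ _ 0); last by rewrite g0// normc_zero.
  by rewrite leNgt; apply/negP => gz0; apply: gz; exists z.
have [r r1 rg] := pser_decay cs gb0.
pose t := Num.max r (normc b0).
have t1 : t < 1 by rewrite gt_max r1.
have [|z zt|b bt bmax] := @compact_disc_max g t.
- by rewrite le_max normc_ge0 orbT.
- have z1 := le_lt_trans zt t1.
  have FN : ProperFilter (nbhs z) := nbhs_pfilter z.
  have nz : normc w @[w --> z] --> normc z by apply: cvgC_norm; exact: cvg_id.
  have pz := @cvgC_norm _ _ _ FN _ _ (pser_continuous (nsq_bounded cs) z1).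
  have sz := cvg_sqr pz; have sn := cvg_sqr nz.
  by apply: cvgM; [apply: cvgB; [exact: cvg_cst|exact: sn]|exact: sz].
exists b; first exact: le_lt_trans bt t1.
move=> z z1; have [zt|tz] := leP (normc z) t; first exact: bmax.
have b0b : g b0 <= g b by apply: bmax; rewrite le_max lexx orbT.
apply: le_trans b0b; apply: ltW; apply: rg; first exact: z1.
by apply: le_lt_trans tz; rewrite le_max lexx.
Qed.

End maximizer.

(** * Residuals of a greedy chain and their decay *)

Section greedy_convergence.
Context {R : realType}.
Implicit Types (z b : R[i]).

(* The coefficient sequences [c k] of the remainders, the points [a k], the
   coefficients [sg k], and the squared norms [s k]. *)
Record afd_chain (c : nat -> nat -> R[i]) (a sg : nat -> R[i]) (s : nat -> R) := AfdChain {
  chain_disc : forall k, normc (a k) < 1 ;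
  chain_nsq : forall k, is_nsq (c k) (s k) ;
  chain_step : forall k, s k.+1 = s k - normc (sg k) ^+ 2 ;
  chain_split : forall k, exists W, [/\ W 0%N = 0, normc (W n) @[n --> \oo] --> (0 : R),
    c k = plus_coef (a k) (sg k) W & c k.+1 = minus_coef (a k) W] }.

Arguments chain_nsq {c a sg s} _ k.

Section chain.
Variables (c : nat -> nat -> R[i]) (a sg : nat -> R[i]) (s : nat -> R).
Hypothesis ch : afd_chain c a sg s.

(* [r] is the coefficient sequence of the n-th residual of [c m]. The last
   clause encodes that it is orthogonal to its complement in [c m]. *)
Lemma chain_residual n m : exists r, [/\ is_nsq r (s (m + n)%N),
  forall z, normc z < 1 ->
    pser r z = (\prod_(l < n) blaschke (a (m + l)%N) z) * pser (c (m + n)%N) z,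
  forall z, normc z < 1 ->
    pser r z = pser (c m) z - \sum_(k < n) sg (m + k)%N * (szego (a (m + k)%N) z
      * \prod_(l < k) blaschke (a (m + l)%N) z)
  & forall x : R, is_nsq (fun l => c m l - x%:C * r l)
      (s m - s (m + n)%N + (1 - x) ^+ 2 * s (m + n)%N)].
Proof.
elim: n m => [|n IH] m.
  exists (c m); rewrite addn0; split.
  - exact: chain_nsq ch m.
  - by move=> z _; rewrite big_ord0 mul1r.
  - by move=> z _; rewrite big_ord0 subr0.
  - move=> x; rewrite subrr add0r /is_nsq.
    rewrite (_ : series _ = fun n => (1 - x) ^+ 2 * series (fun l => normc (c m l) ^+ 2) n).
      by apply: cvgM; [exact: cvg_cst|exact: chain_nsq ch m].
    apply/funext => n; rewrite /series/= mulr_sumr; apply: eq_bigr => l _.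
    rewrite (_ : c m l - _ = (1 - x)%:C * c m l); last by rewrite rmorphB/= rmorph1; ring.
    by rewrite normcM exprMn normc_real real_normK ?num_real.
(* The first step of the chain is peeled off, not the last: the residual of [c m] is
   [blaschke (a m)] times that of [c m.+1], and on coefficients this product is
   [plus_coef (a m) 0 Y]. *)
have [r' [r's r'p r'e r'x]] := IH m.+1.
have [W [W0 Wc cE c1E]] := chain_split ch m.
have a1 := chain_disc ch m.
have [Y [Y0 Yc r'E]] := minus_coef_split a1 (nsq_coef_cvg0 r's).
have pr := pser_plus_coef 0 a1 Y0 Yc; have pc := pser_plus_coef (sg m) a1 W0 Wc.
have idx k : (m.+1 + k = m + k.+1)%N by rewrite addSnnS.
have prE z : normc z < 1 -> pser (plus_coef (a m) 0 Y) z = blaschke (a m) z * pser r' z.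
  by move=> z1; rewrite pr// mul0r add0r -r'E.
exists (plus_coef (a m) 0 Y); split.
- have := (nsq_plus_minus 0 (s (m + n.+1)%N) a1 Y0 Yc).1.
  by rewrite normc_zero expr0n add0r; apply; rewrite -r'E -idx.
- move=> z z1; rewrite prE// r'p// big_ord_recl addn0 mulrA idx.
  by congr (_ * _ * _); apply: eq_bigr => l _; rewrite idx.
- move=> z z1; rewrite prE// r'e// cE pc// -c1E big_ord_recl big_ord0 addn0 mulr1.
  set S := \sum_(k < n) _; set S' := \sum_(k < n) _.
  have -> : S' = blaschke (a m) z * S.
    rewrite mulr_sumr; apply: eq_bigr => k _.
    rewrite -idx big_ord_recl addn0 [RHS]mulrCA; congr (_ * _).
    rewrite [RHS]mulrCA; congr (_ * (_ * _)).
    by apply: eq_bigr => l _; rewrite idx.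
  by ring.
- move=> x.
  (* [plus_coef (a m)] is linear in the pair [(sg, W)], so subtracting [x r] only changes [W] into
     [W - x Y], and the isometry applies to the combination. *)
  have YW : forall l, c m l - x%:C * plus_coef (a m) 0 Y l =
      plus_coef (a m) (sg m) (fun l => W l - x%:C * Y l) l.
    by move=> l; rewrite {1}cE /plus_coef; ring.
  have W0' : W 0%N - x%:C * Y 0%N = 0 by rewrite W0 Y0 mulr0 subr0.
  have Wc' : normc (W n - x%:C * Y n) @[n --> \oo] --> (0 : R).
    apply: (@squeeze_cvgr _ _ _ _ (cst 0) (fun n => normc (W n) + `|x| * normc (Y n))).
    - apply: nearW => l; rewrite normc_ge0/= (le_trans (normc_triangleB _ _))//.
      by rewrite normcM normc_real.
    - exact: cvg_cst.
    - rewrite (_ : 0 = 0 + `|x| * 0 :> R); last by rewrite mulr0 addr0.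
      by apply: cvgD => //; apply: cvgM => //; exact: cvg_cst.
  have := (nsq_plus_minus (sg m) (s m.+1 - s (m.+1 + n)%N +
    (1 - x) ^+ 2 * s (m.+1 + n)%N) a1 W0' Wc').1.
  rewrite (_ : minus_coef _ _ = fun l => c m.+1 l - x%:C * r' l); last first.
    by apply/funext => l; rewrite c1E r'E /minus_coef; ring.
  move=> /(_ (r'x x)); rewrite /is_nsq (chain_step ch) idx.
  rewrite (_ : normc (sg m) ^+ 2 + _ = s m - s (m + n.+1)%N +
    (1 - x) ^+ 2 * s (m + n.+1)%N); last by ring.
  by under [X in series X]eq_fun do rewrite -YW.
Qed.

Lemma chain_antitone n : s n.+1 <= s n.
Proof. by rewrite (chain_step ch) gerBl sqr_ge0. Qed.

(** The squared norms decrease and are nonnegative, hence converge; [|sg n|^2] is the difference of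
    two consecutive ones. *)
Lemma chain_sg_cvg0 : normc (sg n) ^+ 2 @[n --> \oo] --> (0 : R).
Proof.
have [l sl] : exists l : R, s @ \oo --> l.
  suff : cvgn s by move=> /cvg_ex.
  apply: nonincreasing_is_cvgn.
    by apply/nonincreasing_seqP; exact: chain_antitone.
  by exists 0 => _ [n _ <-]; exact: nsq_ge0 (chain_nsq ch n).
rewrite (_ : (fun n => _) = fun n => s n - s n.+1); last first.
  by apply/funext => n; rewrite (chain_step ch) opprB addrC subrK.
by rewrite -(subrr l); apply: cvgB => //; rewrite (cvg_shiftS s).
Qed.

End chain.

(** Follows from [|1 - a^* z|^2 - |z - a|^2 = (1 - |a|^2) (1 - |z|^2)]. *)
Lemma normc_blaschke_le1 (a z : R[i]) : normc a < 1 -> normc z < 1 ->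
  normc (blaschke a z) <= 1.
Proof.
move=> a1 z1; have n0 := one_sub_conjM_neq0 a1 (ltW z1).
rewrite /blaschke normcM normcV ler_pdivrMr; last first.
  by rewrite lt_def normc_ge0 normc_eq0 n0.
rewrite mul1r -(ler_pXn2r (ltn0Sn 1)) ?nnegrE ?normc_ge0//.
have a2 : normc a ^+ 2 < 1 by rewrite expr_lt1 ?normc_ge0.
have z2 : normc z ^+ 2 < 1 by rewrite expr_lt1 ?normc_ge0.
have : 0 <= (1 - normc a ^+ 2) * (1 - normc z ^+ 2).
  by rewrite mulr_ge0// subr_ge0 ltW.
rewrite !sqr_normcE; case: a z {a1 z1 n0 a2 z2} => [ax ay] [zx zy] /=; lra.
Qed.

(** Induction on [l]: remove the constant term and divide by [z]. The division says nothing at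
    [z = 0], where the new series is instead compared with its value at a small real point [t]. *)
Lemma coef_cvg0 (r : nat -> nat -> R[i]) M : (forall n, bounded_coef (r n) M) ->
  (forall z, normc z < 1 -> normc (pser (r n) z) @[n --> \oo] --> (0 : R)) ->
  forall l, normc (r n l) @[n --> \oo] --> (0 : R).
Proof.
move=> + + l; elim: l r => [|l IH] r rM rp.
  rewrite (_ : (fun n => normc (r n 0%N)) = fun n => normc (pser (r n) 0)).
    by apply: rp; rewrite normc_zero.
  by apply/funext => n; rewrite (pser_shift (rM n)) ?normc_zero// mul0r addr0.
have M0 : 0 <= M := le_trans (normc_ge0 _) (rM 0%N 0%N).
have r1M n : bounded_coef (fun l => r n l.+1) M by move=> k; exact: rM.
have r0 : normc (r n 0%N) @[n --> \oo] --> (0 : R).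
  rewrite (_ : (fun n => normc (r n 0%N)) = fun n => normc (pser (r n) 0)).
    by apply: rp; rewrite normc_zero.
  by apply/funext => n; rewrite (pser_shift (rM n)) ?normc_zero// mul0r addr0.
have nz z : z != 0 -> normc z < 1 ->
    normc (pser (fun l => r n l.+1) z) @[n --> \oo] --> (0 : R).
  move=> z0 z1; have nz0 : normc z != 0 by rewrite normc_eq0.
  apply: (@squeeze_cvgr _ _ _ _ (cst 0) (fun n => (normc (pser (r n) z) +
      normc (r n 0%N)) / normc z)).
  - apply: nearW => n; rewrite normc_ge0/= ler_pdivlMr; last first.
      by rewrite lt_def nz0 normc_ge0.
    rewrite mulrC -normcM (_ : z * _ = pser (r n) z - r n 0%N).
      exact: normc_triangleB.
    by rewrite (pser_shift (rM n) z1) addrC addKr.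
  - exact: cvg_cst.
  - rewrite (_ : 0 = (0 + 0) / normc z :> R); last by rewrite addr0 mul0r.
    by apply: cvgM; [apply: cvgD => //; exact: rp|exact: cvg_cst].
apply: (IH (fun n l => r n l.+1)) => // z z1.
have [->|z0] := eqVneq z 0; last exact: nz.
apply/cvg0_normcP => e e0.
(* [t <= 1 / 2] gives [M / (1 - t) <= 2 * M], and [t * (4 * M + 1) <= e] then makes the change
   between 0 and [t], at most [2 * M * t], smaller than [e / 2]. *)
pose t := Num.min (1 / 2) (e / (4 * M + 1)).
have D0 : 0 < 4 * M + 1 by rewrite ltr_wpDl ?mulr_ge0.
have t0 : 0 < t by rewrite lt_min !divr_gt0.
have t12 : t <= 1 / 2 by rewrite ge_min lexx.
have te : t * (4 * M + 1) <= e.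
  by rewrite -ler_pdivlMr// ge_min lexx orbT.
have nt : normc (t%:C : R[i]) = t by rewrite normc_real gtr0_norm.
have t1 : normc (t%:C : R[i]) < 1 by rewrite nt; lra.
have tC0 : t%:C != 0 :> R[i] by rewrite -normc_eq0 nt gt_eqF.
have e2 : 0 < e / 2 by rewrite divr_gt0.
have /cvg0_normcP/(_ _ e2) := nz _ tC0 t1.
apply: filterS => n h.
have r2M : bounded_coef (fun l => r n l.+2) M by move=> k; exact: rM.
have n01 : normc (0 : R[i]) < 1 by rewrite normc_zero.
have := normc_pser_le r2M t1; rewrite nt => h2.
have h3 : M / (1 - t) <= 2 * M.
  rewrite ler_pdivrMr; last by lra.
  nra.
rewrite (pser_shift (r1M n) n01) mul0r addr0.
have E := pser_shift (r1M n) t1.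
rewrite (_ : r n 1%N = pser (fun l => r n l.+1) t%:C - t%:C * pser (fun l => r n l.+2) t%:C); last first.
  by rewrite E addrK.
rewrite (le_lt_trans (normc_triangleB _ _))// normcM nt.
have : t * normc (pser (fun l => r n l.+2) t%:C) <= t * (2 * M).
  by apply: ler_wpM2l; [exact: ltW|exact: le_trans h2 h3].
nra.
Qed.

Lemma greedy_cvg (c : nat -> nat -> R[i]) (a sg : nat -> R[i]) (s : nat -> R) :
  afd_chain c a sg s ->
  (forall k b, normc b < 1 ->
    (1 - normc b ^+ 2) * normc (pser (c k) b) ^+ 2 <= normc (sg k) ^+ 2) ->
  s @ \oo --> (0 : R).
Proof.
move=> ch mx.
have /choice[r rP] : forall n, exists r, [/\ is_nsq r (s n),
    forall z, normc z < 1 -> normc (pser r z) <= normc (pser (c n) z)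
  & is_nsq (fun l => c 0%N l + r l) (s 0%N + 3 * s n)].
  move=> n; have [r [rs rp _ rx]] := chain_residual ch n 0.
  exists r; split => //.
    move=> z z1; rewrite rp// normcM ler_piMl ?normc_ge0//.
    elim/big_ind : _ => [|x y x1 y1|l _]; first by rewrite normc_one.
      by rewrite normcM mulr_ile1 ?normc_ge0.
    by apply: normc_blaschke_le1 => //; exact: chain_disc ch _.
  (* At [x = -1] the orthogonality clause reads [|c 0 + r|^2 = s 0 + 3 * s n], which hides the cross
     term [2 Re <c 0, r> = 2 * s n]. *)
  have := rx (- 1); rewrite add0n.
  rewrite (_ : s 0%N - _ + _ = s 0%N + 3 * s n); last by ring.
  congr is_nsq; apply/funext => l.
  by rewrite rmorphN/= rmorph1 mulN1r opprK.
have s0 n : 0 <= s n by exact: nsq_ge0 (chain_nsq ch n).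
have sdec n : s n <= s 0%N.
  by elim: n => // n; apply: le_trans; exact: chain_antitone ch n.
have rM n : bounded_coef (r n) (Num.sqrt (s 0%N)).
  move=> l; have [/nsq_bounded/(_ l) h _ _] := rP n.
  by rewrite (le_trans h)// ler_sqrt.
have rp z : normc z < 1 -> normc (pser (r n) z) @[n --> \oo] --> (0 : R).
  move=> z1; have q0 : 0 < 1 - normc z ^+ 2 by rewrite subr_gt0 expr_lt1 ?normc_ge0.
  have h : normc (pser (r n) z) ^+ 2 @[n --> \oo] --> (0 : R).
    apply: (@squeeze_cvgr _ _ _ _ (cst 0) (fun n => normc (sg n) ^+ 2 / (1 - normc z ^+ 2))).
    - apply: nearW => n; rewrite sqr_ge0/= ler_pdivlMr// mulrC.
      apply: le_trans (mx n z z1); rewrite ler_pM2l//.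
      by rewrite ler_pXn2r// ?nnegrE ?normc_ge0//; case: (rP n) => _ /(_ z z1).
    - exact: cvg_cst.
    - rewrite -[X in _ --> X](mul0r (1 - normc z ^+ 2)^-1).
      by apply: cvgM; [exact: chain_sg_cvg0 ch|exact: cvg_cst].
  have : Num.sqrt (normc (pser (r n) z) ^+ 2) @[n --> \oo] --> Num.sqrt (0 : R).
    by apply: continuous_cvg h; exact: sqrt_continuous.
  by rewrite sqrtr0; under eq_fun do rewrite sqrtr_sqr ger0_norm ?normc_ge0//.
have rl := coef_cvg0 rM rp.
apply/cvgrPdist_lt => e e0; have e4 : 0 < e / 4 by rewrite divr_gt0.
have c0 := chain_nsq ch 0.
have [L SL] := nsq_tail_lt c0 e4.
set S := series _ in SL.
pose hd n := \sum_(l < L) normc (c 0%N l + r n l) ^+ 2.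
have hdc : hd @ \oo --> S L.
  rewrite /S /series/= big_mkord.
  apply: (@cvg_sum_ord _ R _ _ _ L (fun l n => normc (c 0%N l + r n l) ^+ 2)
    (fun l => normc (c 0%N l) ^+ 2)) => l.
  have := rl l => {}rl.
  have : c 0%N l + r n l @[n --> \oo] --> c 0%N l.
    apply/cvgC_normP; rewrite (_ : (fun n => normc _) = fun n => normc (r n l))//.
    by apply/funext => n; rewrite addrC addKr.
  by move=> /cvgC_norm h; rewrite expr2; under eq_fun do rewrite expr2; exact: cvgM.
(* Split [|c 0 + r n|^2 = s 0 + 3 * s n] at index [L]: the head is [hd n], which converges to [S L],
   and the tail is at most twice the tail of [c 0] plus [2 * s n]. Since 3 exceeds 2, one [s n] is
   left over and gets bounded. *)
have key n : s n <= hd n - S L + (s 0%N - S L).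
  have [rs _ crs] := rP n.
  suff : s 0%N + 3 * s n <= hd n + 2 * (s 0%N - S L) + 2 * s n by lra.
  pose f k := series (fun l => normc (c 0%N l + r n l) ^+ 2) (k + L)%N.
  pose g k := hd n + 2 * series (fun l => normc (tail_coef L (c 0%N) l) ^+ 2) (k + L)%N
    + 2 * series (fun l => normc (r n l) ^+ 2) (k + L)%N.
  have fl : f @ \oo --> s 0%N + 3 * s n by rewrite (cvg_shiftn L (series _)).
  have gl : g @ \oo --> hd n + 2 * (s 0%N - S L) + 2 * s n.
    apply: cvgD; [apply: cvgD; first exact: cvg_cst|];
      (apply: cvgM; first exact: cvg_cst).
      by rewrite (cvg_shiftn L (series _)); exact: nsq_tail c0.
    by rewrite (cvg_shiftn L (series _)).
  apply: (ler_cvg_to fl gl); apply: nearW; rewrite /f /g.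
  elim => [|k IH].
    rewrite add0n /hd -(big_mkord xpredT (fun l => normc (c 0%N l + r n l) ^+ 2)) -addrA lerDl.
    by rewrite addr_ge0// mulr_ge0// /series/= sumr_ge0// => *; exact: sqr_ge0.
  rewrite addSn !seriesSr {2}/tail_coef ltnNge leq_addl/=.
  have := sqr_normcD_le (c 0%N (k + L)%N) (r n (k + L)%N).
  move: IH; lra.
have /cvgrPdist_lt/(_ _ e4) := hdc; apply: filterS => n hn.
rewrite sub0r normrN ger0_norm//.
have := le_lt_trans (ler_norm _) hn; have := key n.
by move: hn; rewrite distrC => /(le_lt_trans (ler_norm _)); lra.
Qed.

End greedy_convergence.

(** * The parametrization of the unit circle *)

Section expi_theory.
Context {R : realType}.
Implicit Types (x y t : R).

Lemma expiD x y : expi (x + y) = expi x * expi y.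
Proof.
by apply/eqP; rewrite eq_complex /= cosD sinD; apply/andP; split; apply/eqP; ring.
Qed.

Lemma expi0 : expi 0 = 1 :> R[i].
Proof. by rewrite /expi cos0 sin0. Qed.

Lemma expiN x : expi (- x) = (expi x)^*.
Proof. by rewrite /expi cosN sinN. Qed.

Lemma expiMn x n : expi (n%:R * x) = expi x ^+ n.
Proof.
elim: n => [|n IH]; first by rewrite mul0r expi0.
by rewrite exprSr -IH -natr1 mulrDl mul1r expiD.
Qed.

Lemma normc_expi x : normc (expi x) = 1.
Proof. by rewrite /expi/= cos2Dsin2 sqrtr1. Qed.

Lemma expi_pi2 : expi (2 * pi) = 1 :> R[i].
Proof. by rewrite /expi mulr2n mulrDl mul1r -mulr2n cos2pi sin2pi. Qed.

Lemma cvg_expi t : expi s @[s --> t] --> expi t.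
Proof.
have cc := @continuous_cos R t; have cs := @continuous_sin R t.
by apply: (@cvgC_ReIm _ _ _ (nbhs_pfilter t)); [exact: cc|exact: cs].
Qed.

End expi_theory.

(** * Integrals of complex-valued functions *)

Section complex_integral.
Context {R : realType}.
Local Notation mu := (@lebesgue_measure R).
Implicit Types (D : set (measurableTypeR R)) (h k : R -> R[i]).

Definition Cintegrable D h :=
  mu.-integrable D (EFin \o (fun t => Re (h t))) /\
  mu.-integrable D (EFin \o (fun t => Im (h t))).

Lemma CintegrableD D h k : measurable D -> Cintegrable D h -> Cintegrable D k ->
  Cintegrable D (fun t => h t + k t).
Proof.
move=> mD [hR hI] [kR kI]; split.
  rewrite (_ : _ \o _ = (EFin \o (fun t => Re (h t))) \+ (EFin \o (fun t => Re (k t))))%E.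
    exact: integrableD.
  by apply/funext => t /=; rewrite ReD EFinD.
rewrite (_ : _ \o _ = (EFin \o (fun t => Im (h t))) \+ (EFin \o (fun t => Im (k t))))%E.
  exact: integrableD.
by apply/funext => t /=; rewrite ImD EFinD.
Qed.

Lemma integrable_comb D (f g : R -> R) (a b : R) : measurable D ->
  mu.-integrable D (EFin \o f) -> mu.-integrable D (EFin \o g) ->
  mu.-integrable D (EFin \o (fun t => a * f t + b * g t)) /\
  \int[mu]_(t in D) (a * f t + b * g t) =
  a * \int[mu]_(t in D) f t + b * \int[mu]_(t in D) g t.
Proof.
move=> mD fi gi.
have fi' : mu.-integrable D (EFin \o (fun t => a * f t)) := integrableZl mD a fi.
have gi' : mu.-integrable D (EFin \o (fun t => b * g t)) := integrableZl mD b gi.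
split; last by rewrite RintegralD// !RintegralZl.
exact: (integrableD mD fi' gi').
Qed.

Lemma CintegrableZ D h (c : R[i]) : measurable D -> Cintegrable D h ->
  Cintegrable D (fun t => c * h t) /\
  Cintegral D (fun t => c * h t) = c * Cintegral D h.
Proof.
move=> mD [hR hI].
have [i1 e1] := integrable_comb (Re c) (- Im c) mD hR hI.
have [i2 e2] := integrable_comb (Im c) (Re c) mD hR hI.
have E1 : (fun t => Re (c * h t)) = fun t => Re c * Re (h t) + - Im c * Im (h t).
  by apply/funext => t; rewrite ReM mulNr.
have E2 : (fun t => Im (c * h t)) = fun t => Im c * Re (h t) + Re c * Im (h t).
  by apply/funext => t; rewrite ImM addrC.
split; first by rewrite /Cintegrable E1 E2.
rewrite /Cintegral E1 E2 e1 e2; case: c {i1 e1 i2 e2 E1 E2} => x y /=.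
by apply/eqP; rewrite eq_complex /=; apply/andP; split; apply/eqP; ring.
Qed.

Lemma CintegralD D h k : measurable D -> Cintegrable D h -> Cintegrable D k ->
  Cintegral D (fun t => h t + k t) = Cintegral D h + Cintegral D k.
Proof.
move=> mD [hR hI] [kR kI]; rewrite /Cintegral.
under eq_Rintegral do rewrite ReD.
under [X in _ +i* X]eq_Rintegral do rewrite ImD.
by rewrite !RintegralD.
Qed.

Lemma Cintegral_sum D (I : Type) (r : seq I) (F : I -> R -> R[i]) : measurable D ->
  (forall i, Cintegrable D (F i)) ->
  Cintegrable D (fun t => \sum_(i <- r) F i t) /\
  Cintegral D (fun t => \sum_(i <- r) F i t) = \sum_(i <- r) Cintegral D (F i).
Proof.
move=> mD Fi; elim: r => [|i r [IH1 IH2]].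
  have E : (fun t : R => \sum_(i <- [::]) F i t) = fun=> 0.
    by apply/funext => t; rewrite big_nil.
  rewrite E big_nil; split.
    by split; exact: integrable0.
  by rewrite /Cintegral /= !Rintegral_cst//= !mul0r.
have E : (fun t : R => \sum_(j <- i :: r) F j t) = fun t => F i t + \sum_(j <- r) F j t.
  by apply/funext => t; rewrite big_cons.
rewrite E big_cons -IH2; split; first exact: CintegrableD.
exact: CintegralD.
Qed.

Lemma continuous_Cintegrable h (al be : R) :
  (forall t, h s @[s --> t] --> h t) -> Cintegrable `[al, be] h.
Proof.
move=> hc; split; apply: continuous_compact_integrable; try exact: segment_compact.
  by apply: continuous_subspaceT => t; exact: cvgC_Re (hc t).
by apply: continuous_subspaceT => t; exact: cvgC_Im (hc t).
Qed.

Lemma Rintegral_FTC (F f : R -> R) (al be : R) : al < be ->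
  (forall t : R, is_derive t 1 F (f t)) -> continuous f ->
  \int[mu]_(t in `[al, be]) f t = F be - F al.
Proof.
move=> ab dF fc.
have Fc t : F s @[s --> t] --> F t.
  by apply: differentiable_continuous; apply/derivable1_diffP; case: (dF t).
rewrite /Rintegral (@continuous_FTC2 _ f F)//.
- exact: continuous_subspaceT.
- split.
  + by move=> t _; case: (dF t).
  + exact: cvg_at_right_filter.
  + exact: cvg_at_left_filter.
- by move=> t _; rewrite derive1E; case: (dF t).
Qed.

Lemma Cintegral_expi (al be w : R) : al < be -> w != 0 ->
  expi (w * al) = expi (w * be) -> Cintegral `[al, be] (fun t => expi (w * t)) = 0.
Proof.
move=> ab w0 [cab sab].
have wc (t : R) : w * s @[s --> t] --> w * t by apply: cvgM; [exact: cvg_cst|exact: cvg_id].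
have dw (t : R) : is_derive t 1 ( *%R w) w.
  have := @is_deriveZ _ _ _ id w t 1 1 (is_derive_id t 1).
  by rewrite /GRing.scale/= mulr1.
have ds (t : R) : is_derive t 1 (fun t : R => w^-1 * sin (w * t)) (cos (w * t)).
  have h := @is_derive1_comp _ sin ( *%R w) t _ _ (is_derive_sin (w * t)) (dw t).
  have := @is_deriveZ _ _ _ _ w^-1 t 1 _ h.
  by congr is_derive; rewrite /GRing.scale/=; field.
have dc (t : R) : is_derive t 1 (fun t : R => - w^-1 * cos (w * t)) (sin (w * t)).
  have h := @is_derive1_comp _ cos ( *%R w) t _ _ (is_derive_cos (w * t)) (dw t).
  have := @is_deriveZ _ _ _ _ (- w^-1) t 1 _ h.
  by congr is_derive; rewrite /GRing.scale/=; field.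
have csc : continuous (fun t : R => cos (w * t)).
  move=> t; apply: (@continuous_comp _ _ _ ( *%R w) cos); first exact: wc.
  exact: continuous_cos.
have css : continuous (fun t : R => sin (w * t)).
  move=> t; apply: (@continuous_comp _ _ _ ( *%R w) sin); first exact: wc.
  exact: continuous_sin.
rewrite /Cintegral /= (Rintegral_FTC ab ds csc) (Rintegral_FTC ab dc css).
by rewrite cab sab !subrr.
Qed.

Lemma Cintegral_cst (al be : R) (c : R[i]) : al <= be ->
  Cintegral `[al, be] (fun=> c) = (be - al)%:C * c.
Proof.
move=> ab; rewrite /Cintegral /= !Rintegral_cst//= lebesgue_measure_itv/= lte_fin.
have -> : fine (if al < be then (be%:E - al%:E)%E else 0%E) = be - al.
  by case: ltgtP ab => //= -> _; rewrite subrr.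
case: c => x y; apply/eqP; rewrite eq_complex /=.
by apply/andP; split; apply/eqP; ring.
Qed.

End complex_integral.

(** * Orthogonality of trigonometric polynomials *)

Section trigonometric_polynomials.
Context {R : realType}.
Local Notation mu := (@lebesgue_measure R).
Implicit Types (c d : nat -> R[i]) (al be t : R).

Definition tpoly N c t : R[i] := \sum_(l < N) c l * expi t ^+ l.

Lemma cvg_expi_exp l t : expi s ^+ l @[s --> t] --> (expi t ^+ l : R[i]).
Proof.
elim: l => [|l IH]; first by under eq_fun do rewrite expr0; exact: cvg_cst.
under eq_fun do rewrite exprS; rewrite exprS.
by apply: cvgM; [exact: cvg_expi|exact: IH].
Qed.

Lemma cvg_conj (T : Type) (F : set_system T) {FF : ProperFilter F} (f : T -> R[i]) z :
  f @ F --> z -> (f t)^* @[t --> F] --> z^*.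
Proof.
move=> /cvgC_normP fz; apply/cvgC_normP.
by under eq_fun do rewrite -rmorphB normc_conj.
Qed.

Lemma cvg_tpoly N c t : tpoly N c s @[s --> t] --> tpoly N c t.
Proof.
rewrite /tpoly; apply: (@cvg_sum_ord _ R[i] _ _ (nbhs_filter t) N (fun l s => c l * expi s ^+ l)
  (fun l => c l * expi t ^+ l)) => l.
by apply: cvgM; [exact: cvg_cst|exact: cvg_expi_exp].
Qed.

Section period.
Variables (al be : R) (ab : al < be) (pab : expi al = expi be :> R[i]).

(** The interval is any one whose endpoints have the same image on the circle: the results serve on
    [[0, 2 pi]], on [[t - pi, t + pi]] and on the three periods [[- 2 pi, 4 pi]]. *)
Lemma Cintegral_expi_expJ l m :
  Cintegral `[al, be] (fun t => expi t ^+ l * (expi t ^+ m)^*) =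
  (be - al)%:C * (l == m)%:R.
Proof.
have [->|lm] := eqVneq l m.
  rewrite -(Cintegral_cst _ (ltW ab)); congr Cintegral; apply/funext => t.
  by rewrite mulc_conj normc_exp normc_expi !expr1n.
have E t : expi ((l%:R - m%:R) * t) = expi t ^+ l * (expi t ^+ m)^* :> R[i].
  by rewrite mulrBl expiD expiN !expiMn.
rewrite mulr0 (_ : (fun t => _) = fun t => expi ((l%:R - m%:R) * t)); last first.
  by apply/funext => t; rewrite E.
apply: (Cintegral_expi ab); last by rewrite !E pab.
by rewrite subr_eq0 eqr_nat.
Qed.

Lemma Cintegral_expi_exp l :
  Cintegral `[al, be] (fun t => expi t ^+ l) = (be - al)%:C * (l == 0)%:R.
Proof.
rewrite -Cintegral_expi_expJ; congr Cintegral; apply/funext => t.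
by rewrite expr0 rmorph1 mulr1.
Qed.

Let cI h := @continuous_Cintegrable R h al be.
Let mI : measurable (`[al, be]%classic : set (measurableTypeR R)) := measurable_itv `[al, be].

Lemma Cintegral_tpolyJ N c d :
  Cintegral `[al, be] (fun t => tpoly N c t * (tpoly N d t)^*) =
  (be - al)%:C * \sum_(l < N) c l * (d l)^*.
Proof.
have E : (fun t => tpoly N c t * (tpoly N d t)^*) = fun t => \sum_(l < N) \sum_(m < N)
    (c l * (d m)^*) * (expi t ^+ l * (expi t ^+ m)^*).
  apply/funext => t; rewrite /tpoly rmorph_sum mulr_suml; apply: eq_bigr => l _.
  by rewrite mulr_sumr; apply: eq_bigr => m _; rewrite rmorphM/=; ring.
have i1 (l m : 'I_N) : Cintegrable `[al, be] (fun t => expi t ^+ l * (expi t ^+ m)^*).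
  apply: cI => t; apply: cvgM; first exact: cvg_expi_exp.
  by apply: (@cvg_conj _ _ (nbhs_pfilter t)); exact: cvg_expi_exp.
have i2 (l m : 'I_N) := CintegrableZ (c l * (d m)^*) mI (i1 l m).
have i3 (l : 'I_N) := Cintegral_sum (index_enum 'I_N) mI (fun m => (i2 l m).1).
have [_ i4] := Cintegral_sum (index_enum 'I_N) mI (fun l => (i3 l).1).
rewrite E i4 mulr_sumr; apply: eq_bigr => l _; rewrite (i3 l).2 (bigD1 l)//=.
rewrite (i2 l l).2 Cintegral_expi_expJ eqxx mulr1 big1 ?addr0; first by ring.
move=> m ml; rewrite (i2 l m).2 Cintegral_expi_expJ eq_sym.
by rewrite (_ : (m : nat) == l = false) ?mulr0//; apply/negbTE.
Qed.

(** All frequencies of the product are at least 1. This lets the other half of the Poisson kernel be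
    added to a Cauchy integral without changing its value. *)
Lemma Cintegral_tpolyM N c d :
  Cintegral `[al, be] (fun t => tpoly N c t * (expi t * tpoly N d t)) = 0.
Proof.
have E : (fun t => tpoly N c t * (expi t * tpoly N d t)) = fun t => \sum_(l < N) \sum_(m < N)
    (c l * d m) * expi t ^+ (l + m).+1.
  apply/funext => t; rewrite /tpoly mulr_suml; apply: eq_bigr => l _.
  by rewrite mulr_sumr mulr_sumr; apply: eq_bigr => m _; rewrite exprS exprD; ring.
have i1 (l m : 'I_N) : Cintegrable `[al, be] (fun t => expi t ^+ (l + m).+1).
  by apply: cI => t; exact: cvg_expi_exp.
have i2 (l m : 'I_N) := CintegrableZ (c l * d m) mI (i1 l m).
have i3 (l : 'I_N) := Cintegral_sum (index_enum 'I_N) mI (fun m => (i2 l m).1).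
have [_ i4] := Cintegral_sum (index_enum 'I_N) mI (fun l => (i3 l).1).
rewrite E i4 big1// => l _; rewrite (i3 l).2 big1// => m _.
by rewrite (i2 l m).2 Cintegral_expi_exp mulr0 mulr0.
Qed.

Lemma Rintegral_tpoly_sqr N c :
  \int[mu]_(t in `[al, be]) normc (tpoly N c t) ^+ 2 =
  (be - al) * \sum_(l < N) normc (c l) ^+ 2.
Proof.
have := Cintegral_tpolyJ N c c; rewrite /Cintegral => /(congr1 (@complex.Re R)) /=.
under eq_Rintegral do rewrite mulc_conj /=.
move=> ->; rewrite ReM /= mul0r subr0; congr (_ * _).
by rewrite Re_sum; apply: eq_bigr => l _; rewrite mulc_conj.
Qed.

End period.
End trigonometric_polynomials.

(** * Poisson kernel estimates *)

Section poisson_kernel.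
Context {R : realType}.
Local Notation mu := (@lebesgue_measure R).
Implicit Types (t s r : R).

Lemma ler_of_eq (x y : R) : x = y -> x <= y.
Proof. by move=> ->. Qed.

(** For [0 <= x <= pi / 2], the mean value theorem on [[0, x / 2]] gives [sin (x / 2) >= x / 4], and
    [1 - cos x = 2 sin^2 (x / 2)]. Beyond [pi / 2], [cos x <= 0] and [pi <= 4] suffice. *)
Lemma sqr_le_one_sub_cos (x : R) : `|x| <= pi -> x ^+ 2 / 16 <= 1 - cos x.
Proof.
wlog x0 : x / 0 <= x => [H|].
  have [x0|x0] := leP 0 x; first exact: H.
  rewrite -normrN => xpi; rewrite -sqrrN -cosN; apply: H => //.
  by rewrite oppr_ge0 ltW.
rewrite ger0_norm// => xpi.
have [/andP[_ pi4] _] := pihalf_02_cos_pihalf R.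
have [xh|xh] := leP x (pi / 2); last first.
  have : 0 <= cos (pi - x) by apply: cos_ge0_pihalf; lra.
  rewrite cosB cospi sinpi; nra.
have c0 : 0 <= cos (x / 2) by apply: cos_ge0_pihalf; lra.
move: x0; rewrite le_eqVlt => /predU1P[<-|x0]; first by rewrite cos0; lra.
have x20 : 0 < x / 2 by lra.
have [c /[!in_itv]/= /andP[cl cr]] := MVT x20 (fun x _ => is_derive_sin x)
  (continuous_subspaceT (@continuous_sin R)).
rewrite sin0 !subr0 => sE.
have cc : 1 / 2 <= cos c.
  have c2 : 0 <= cos (c *+ 2) by rewrite mulr2n; apply: cos_ge0_pihalf; lra.
  have c1 : 0 <= cos c by apply: cos_ge0_pihalf; lra.
  by move: c2; rewrite cos_mulr2n mulr2n; nra.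
have h : x / 2 * (1 / 2) <= cos c * (x / 2) by rewrite mulrC ler_wpM2r// ltW.
have cE : cos x = 1 - 2 * (cos c * (x / 2)) ^+ 2.
  have {1}-> : x = (x / 2) *+ 2 by rewrite mulr2n; lra.
  by rewrite cos_mulr2n cos2sin2 sE; ring.
rewrite cE; move: h; set y := cos c * _ => h.
have h2 : (x / 4) ^+ 2 <= y ^+ 2 by rewrite ler_pXn2r// ?nnegrE; lra.
have y2 : 0 <= y ^+ 2 := sqr_ge0 y.
by move: h2 y2; lra.
Qed.

(** Uses [|1 - r e^(it)|^2 = (1 - r)^2 + 2 r (1 - cos t)] with [2 r >= 1]. It compares the Poisson
    kernel with the simpler [d / (d^2 + t^2)], where [d = 1 - r]. *)
Lemma one_sub_expi_sqr_ge r t : 1 / 2 <= r < 1 -> `|t| <= pi ->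
  ((1 - r) ^+ 2 + t ^+ 2) / 16 <= normc (1 - r%:C * expi t) ^+ 2.
Proof.
move=> /andP[r2 r1] /sqr_le_one_sub_cos h; rewrite sqr_normcE /=.
have := cos2Dsin2 t; set C := cos t in h *; set S := sin t => CS.
have -> : (1 - (r * C - 0 * S)) ^+ 2 + (0 - (r * S + 0 * C)) ^+ 2 =
  (1 - r) ^+ 2 + 2 * r * (1 - C) + r ^+ 2 * (C ^+ 2 + S ^+ 2 - 1) by ring.
rewrite CS subrr mulr0 addr0.
have : 0 <= 1 - C by apply: le_trans h; rewrite divr_ge0// sqr_ge0.
have : 0 <= (1 - r) ^+ 2 by exact: sqr_ge0.
nra.
Qed.

Lemma conjcM (z w : R[i]) : conjc (z * w) = conjc z * conjc w.
Proof. exact: rmorphM. Qed.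

Lemma conjc_sum N (f : nat -> R[i]) :
  conjc (\sum_(k < N) f k) = \sum_(k < N) conjc (f k).
Proof. exact: rmorph_sum. Qed.

(** With [e = x ^+ K], a geometric sum and its reflected half split into the full Poisson kernel
    [(1 - |x|^2) / |1 - x|^2] and a truncation error. *)
Lemma poisson_split (x e : R[i]) : 1 - x != 0 ->
  (1 - e) / (1 - x) + (x * ((1 - e) / (1 - x)))^* =
  (1 - x * x^*) / ((1 - x) * (1 - x)^*) - (e / (1 - x) + (x * e / (1 - x))^*).
Proof.
move=> y0; have z0 : (1 - x)^* != 0 by rewrite conjc_eq0.
have cM (u v : R[i]) : (u * v)^* = u^* * v^* by exact: rmorphM.
have cB (u : R[i]) : (1 - u)^* = 1 - u^* by rewrite -[1 in RHS]conjc1; exact: rmorphB.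
have cV (u : R[i]) : (u^-1)^* = (u^*)^-1 by exact: conjc_inv.
move: z0; rewrite !(cM, cV, cB); move: (x^*) (e^*) => xb eb z0.
by field; apply/andP; split; [exact: z0|exact: y0].
Qed.

(* [G] is the analytic half of the truncated Poisson kernel
   sum_(|k| <= K) r^|k| e^(ikt). *)
Lemma poisson_partial_le (x : R[i]) K : 1 / 2 <= normc x < 1 ->
  let G : R[i] := \sum_(k < K) x ^+ k in
  normc (G + (x * G)^*) <= 2 * (1 - normc x) / normc (1 - x) ^+ 2
     + 2 * normc x ^+ K / (1 - normc x).
Proof.
move=> /andP[_ x1]; cbv zeta; set G := \sum_(k < K) _.
have y0 : 1 - x != 0.
  by rewrite subr_eq0; apply: contraTN x1 => /eqP <-; rewrite normc_one ltxx.
have GE : G = (1 - x ^+ K) / (1 - x).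
  apply: (mulIf y0); rewrite divfK// mulrC.
  by rewrite -opprB -[1 - x ^+ K]opprB subrX1 mulNr.
have GE2 : G + (x * G)^* = ((1 - normc x ^+ 2) / normc (1 - x) ^+ 2)%:C
    - (x ^+ K / (1 - x) + (x ^+ K.+1 / (1 - x))^*).
  have -> : ((1 - normc x ^+ 2) / normc (1 - x) ^+ 2)%:C =
      (1 - x * x^*) / ((1 - x) * (1 - x)^*).
    by rewrite !mulc_conj rmorphM fmorphV rmorphB rmorph1.
  rewrite GE exprS.
  exact: poisson_split.
have d0 : 0 < 1 - normc x by rewrite subr_gt0.
have dn : 1 - normc x <= normc (1 - x).
  by rewrite lerBlDr; have := normc_triangle_dist 1 x; rewrite normc_one addrC.
have n0 : 0 < normc (1 - x) by exact: lt_le_trans dn.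
have eK : normc (x ^+ K / (1 - x)) <= normc x ^+ K / (1 - normc x).
  rewrite normcM normcV normc_exp ler_wpM2l ?exprn_ge0 ?normc_ge0//.
  by rewrite lef_pV2.
rewrite GE2 (le_trans (normc_triangleB _ _))// lerD//.
  rewrite normc_real ger0_norm; last first.
    by rewrite divr_ge0 ?sqr_ge0// subr_ge0 exprn_ile1 ?normc_ge0// ltW.
  rewrite ler_wpM2r ?invr_ge0 ?sqr_ge0//; have := normc_ge0 x; nra.
rewrite (le_trans (normc_triangle _ _))// normc_conj exprSr mulrAC (normcM _ x).
have u0 : 0 <= normc (x ^+ K / (1 - x)) := normc_ge0 _.
have ux : normc (x ^+ K / (1 - x)) * normc x <= normc (x ^+ K / (1 - x)).
  by rewrite ler_piMr// ltW.
set A := normc x ^+ K in eK *.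
have -> : 2 * A / (1 - normc x) = A / (1 - normc x) + A / (1 - normc x) by ring.
by apply: lerD; [exact: eK|exact: le_trans ux eK].
Qed.

(** The factor 2 comes from bounding real and imaginary parts separately; it only affects
    constants. *)
Lemma normc_Cintegral_le (D : set (measurableTypeR R)) (h : R -> R[i]) (H : R -> R) :
  measurable D -> Cintegrable D h -> mu.-integrable D (EFin \o H) ->
  (forall t, D t -> normc (h t) <= H t) ->
  normc (Cintegral D h) <= 2 * \int[mu]_(t in D) H t.
Proof.
move=> mD [hR hI] Hi hH; rewrite (le_trans (normc_le_ReIm _))// mulr2n mulrDl mul1r.
apply: lerD; rewrite (le_trans (le_normr_Rintegral mD _))//; apply: le_Rintegral => //.
- exact: integrable_norm.
- by move=> t /hH; apply: le_trans; exact: normRe_le.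
- exact: integrable_norm.
- by move=> t /hH; apply: le_trans; exact: normIm_le.
Qed.

Lemma continuous_itv_integrable (f : R -> R) (al be : R) : continuous f ->
  mu.-integrable `[al, be] (EFin \o f).
Proof.
move=> fc; apply: continuous_compact_integrable; first exact: segment_compact.
exact: continuous_subspaceT.
Qed.

Lemma continuous_normc_tpoly N (c : nat -> R[i]) : continuous (fun t : R => normc (tpoly N c t)).
Proof.
move=> t; have h := @cvgC_norm _ _ _ (nbhs_pfilter t) _ _ (cvg_tpoly (N:=N) (c:=c) (t:=t)).
exact: h.
Qed.

Lemma tpoly_widen N K (c : nat -> R[i]) t : (N <= K)%N ->
  tpoly K (fun l => if (l < N)%N then c l else 0) t = tpoly N c t.
Proof.
move=> NK; rewrite /tpoly (big_ord_widen K (fun l => c l * expi t ^+ l) NK).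
rewrite [RHS]big_mkcond/=; apply: eq_bigr => l _.
by case: ifP => // _; rewrite mul0r.
Qed.

Lemma poisson_kernel_cts (d t : R) : 0 < d ->
  continuous (fun s : R => d / (d ^+ 2 + (s - t) ^+ 2)).
Proof.
move=> d0 s; apply: cvgM; first exact: cvg_cst.
apply: cvgV.
  by rewrite gt_eqF// ltr_wpDr ?sqr_ge0// exprn_gt0.
apply: cvgD; first exact: cvg_cst.
by under eq_fun do rewrite expr2; rewrite expr2; apply: cvgM; apply: cvgB => //; exact: cvg_cst.
Qed.

(** The Cauchy integral over a period gives [2 pi] times the value at [z]. Adding a term of zero
    integral turns its kernel into the truncated Poisson kernel, whose limit has mass bounded
    independently of [r], unlike the Cauchy kernel. Letting [K] tend to infinity removes the
    truncation. *)
Lemma tpoly_poisson N (c : nat -> R[i]) r t : 1 / 2 <= r < 1 ->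
  2 * pi * normc (\sum_(l < N) c l * (r%:C * expi t) ^+ l) <=
  64 * \int[mu]_(s in `[t - pi, t + pi])
    ((1 - r) / ((1 - r) ^+ 2 + (s - t) ^+ 2) * normc (tpoly N c s)).
Proof.
move=> /[dup] r21 /andP[r2 r1].
have pi0 : 0 < pi :> R by exact: pi_gt0.
have d0 : 0 < 1 - r by rewrite subr_gt0.
set al := t - pi; set be := t + pi; set z := r%:C * expi t.
have ab : al < be by rewrite /al /be; lra.
have pab : expi al = expi be :> R[i].
  rewrite (_ : be = al + 2 * pi); last by rewrite /al /be; lra.
  by rewrite expiD expi_pi2 mulr1.
have mI : measurable (`[al, be]%classic : set (measurableTypeR R)) := measurable_itv `[al, be].
set ker := fun s => (1 - r) / ((1 - r) ^+ 2 + (s - t) ^+ 2) * normc (tpoly N c s).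
have kc : continuous ker.
  by move=> s; apply: cvgM; [exact: poisson_kernel_cts|exact: continuous_normc_tpoly].
have ki := continuous_itv_integrable al be kc.
have ni := continuous_itv_integrable al be (@continuous_normc_tpoly N c).
set B := \int[mu]_(s in `[al, be]) normc (tpoly N c s).
have nz : normc z = r by rewrite normcM normc_expi mulr1 normc_real ger0_norm//; lra.
have key K : (N <= K)%N ->
  2 * pi * normc (\sum_(l < N) c l * z ^+ l) <=
  64 * \int[mu]_(s in `[al, be]) ker s + 4 / (1 - r) * B * r ^+ K.
  (* [c'] pads [c] with zeros so that all polynomials have length [K]; [g] yields the Cauchy half of
     the kernel and [g'] the reflected half, which starts at frequency 1. *)
  move=> NK; pose c' l := if (l < N)%N then c l else 0.
  pose g k : R[i] := conjc (z ^+ k); pose g' k : R[i] := conjc z * conjc (z ^+ k).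
  have e1 := Cintegral_tpolyJ ab pab K c' g.
  have e2 := Cintegral_tpolyM ab pab K c' g'.
  have c1 s : tpoly K c' u * conjc (tpoly K g u) @[u --> s] -->
      tpoly K c' s * conjc (tpoly K g s).
    have h := @cvg_conj _ _ _ (nbhs_pfilter s) _ _ (cvg_tpoly (N:=K) (c:=g) (t:=s)).
    apply: cvgM; first exact: cvg_tpoly.
    exact: h.
  have c2 s : tpoly K c' u * (expi u * tpoly K g' u) @[u --> s] -->
      tpoly K c' s * (expi s * tpoly K g' s).
    by apply: cvgM; [exact: cvg_tpoly|apply: cvgM; [exact: cvg_expi|exact: cvg_tpoly]].
  have i1 := continuous_Cintegrable al be c1; have i2 := continuous_Cintegrable al be c2.
  have e3 := CintegralD mI i1 i2; have i3 := CintegrableD mI i1 i2.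
  rewrite e1 e2 addr0 in e3.
  have -> : 2 * pi * normc (\sum_(l < N) c l * z ^+ l) =
      normc ((be - al)%:C * \sum_(l < K) c' l * conjc (g l)).
    rewrite normcM normc_real ger0_norm; last by rewrite subr_ge0 ltW.
    congr (_ * normc _); first by rewrite /al /be; ring.
    rewrite (big_ord_widen K (fun l => c l * z ^+ l) NK) big_mkcond/=.
    by apply: eq_bigr => l _; rewrite /c' /g conjcK; case: ifP => // _; rewrite mul0r.
  rewrite -e3.
  (* 32 is the 2 of [1 - r^2 <= 2 (1 - r)] times the 16 of [one_sub_expi_sqr_ge]; the 2 lost in
     [normc_Cintegral_le] makes it 64. *)
  pose H s := 32 * ker s + (2 / (1 - r) * r ^+ K) * normc (tpoly N c s).
  have [Hi HE] := integrable_comb 32 (2 / (1 - r) * r ^+ K) mI ki ni.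
  apply: (le_trans (normc_Cintegral_le mI i3 Hi _)); last first.
    by rewrite HE -/B; apply: ler_of_eq; ring.
  move=> s /=; rewrite in_itv/= => /andP[s1 s2].
  rewrite -mulrDr normcM tpoly_widen//.
  pose x := z * conjc (expi s).
  have xE : x = r%:C * expi (t - s) by rewrite /x /z expiD expiN mulrA.
  have xn k : x ^+ k = z ^+ k * conjc (expi s ^+ k) by rewrite /x exprMn rmorphXn.
  have xb : conjc x = conjc z * expi s by rewrite /x conjcM conjcK.
  have xnb k : conjc (x ^+ k) = conjc (z ^+ k) * expi s ^+ k.
    by rewrite xn conjcM; congr (_ * _); exact: conjcK.
  have nx : normc x = r by rewrite normcM normc_conj normc_expi mulr1.
  have -> : conjc (tpoly K g s) + expi s * tpoly K g' s =
      \sum_(k < K) x ^+ k + conjc (x * \sum_(k < K) x ^+ k).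
    congr (_ + _).
      rewrite /tpoly (conjc_sum K (fun k => g k * expi s ^+ k)).
      by apply: eq_bigr => k _; rewrite conjcM /g conjcK xn.
    rewrite /tpoly conjcM (conjc_sum K (fun k => x ^+ k)) xb !mulr_sumr.
    apply: eq_bigr => k _; rewrite xnb /g'.
    have swap (u v w y : R[i]) : u * (v * w * y) = v * u * (w * y) by ring.
    exact: swap.
  have st : `|t - s| <= pi by rewrite ler_norml; move: s1 s2; rewrite /al /be; lra.
  have low := one_sub_expi_sqr_ge r21 st.
  have nx21 : 1 / 2 <= normc x < 1 by rewrite nx.
  have := poisson_partial_le K nx21; cbv zeta; rewrite nx xE.
  set D := normc (_ + _); set E := normc (1 - _) in low *; move=> DE.
  rewrite mulrC /ker mulrA -mulrDl ler_wpM2r ?normc_ge0//.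
  apply: (le_trans DE); apply: lerD; last by apply: ler_of_eq; ring.
  have st2 : (s - t) ^+ 2 = (t - s) ^+ 2 by ring.
  rewrite st2; set Q := (1 - r) ^+ 2 + (t - s) ^+ 2 in low *.
  have Q0 : 0 < Q by rewrite /Q ltr_wpDr ?sqr_ge0// exprn_gt0.
  have E0 : 0 < E ^+ 2 by apply: lt_le_trans low; rewrite divr_gt0.
  have q1 : 1 <= 16 * E ^+ 2 / Q by rewrite ler_pdivlMr// mul1r; move: low; lra.
  rewrite ler_pdivrMr//.
  have -> : 32 * ((1 - r) / Q) * E ^+ 2 = 2 * (1 - r) * (16 * E ^+ 2 / Q) by ring.
  by rewrite ler_peMr// mulr_ge0// ltW.
have lim : (fun K => 64 * \int[mu]_(s in `[al, be]) ker s + 4 / (1 - r) * B * r ^+ K)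
    @ \oo --> 64 * \int[mu]_(s in `[al, be]) ker s + 4 / (1 - r) * B * 0.
  apply: cvgD; first exact: cvg_cst.
  by apply: cvgM; [exact: cvg_cst|apply: cvg_expr; rewrite ger0_norm//; lra].
rewrite mulr0 addr0 in lim.
apply: (ler_cvg_to (cvg_cst (2 * pi * normc (\sum_(l < N) c l * z ^+ l))) lim).
by exists N => // K /key.
Qed.

End poisson_kernel.

(** * Weak-type bound through the Hardy-Littlewood maximal function *)

Section maximal_function.
Context {R : realType}.
Local Notation mu := (@lebesgue_measure R).
Implicit Types (t s r M : R) (h : R -> R).

Lemma sum_geometric_half n : \sum_(j < n) (1 / 2 : R) ^+ j <= 2.
Proof.
suff -> : \sum_(j < n) (1 / 2 : R) ^+ j = 2 - 2 * (1 / 2) ^+ n.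
  by rewrite gerBl mulr_ge0// exprn_ge0.
elim: n => [|n IH]; first by rewrite big_ord0 expr0; ring.
by rewrite big_ord_recr /= IH exprS; field.
Qed.

(* Dyadic layers: d / (d^2 + x^2) <= 4 / (4^j d) as soon as |x| >= 2^(j-1) d. *)
Lemma dyadic_layer (d x : R) : 0 < d -> exists2 j, `|x| < 2 ^+ j * d
  & d / (d ^+ 2 + x ^+ 2) <= 4 / (4 ^+ j * d).
Proof.
move=> d0.
have x2 : x ^+ 2 = `|x| ^+ 2 by rewrite real_normK// num_real.
have [n xn] : exists n, `|x| < 2 ^+ n * d.
  exists (Num.bound (`|x| / d)); rewrite -ltr_pdivrMr//.
  have := archi_boundP (divr_ge0 (normr_ge0 x) (ltW d0)) => /lt_trans; apply.
  by rewrite -natrX ltr_nat ltn_expl.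
case: (ex_minnP (ex_intro (fun n => `|x| < 2 ^+ n * d) n xn)) => j xj jmin.
exists j => //; have q0 : 0 < d ^+ 2 + x ^+ 2 by rewrite ltr_pwDl ?sqr_ge0 ?exprn_gt0.
case: j xj jmin => [|j] xj jmin.
  rewrite expr0 mul1r ler_pdivrMr// mulrAC ler_pdivlMr// x2; have := sqr_ge0 `|x|; nra.
have xge : 2 ^+ j * d <= `|x|.
  by rewrite leNgt; apply/negP => /jmin; rewrite ltnn.
have p0 : 0 < 2 ^+ j :> R by rewrite exprn_gt0.
have e4 : 4 ^+ j = 2 ^+ j ^+ 2 :> R by rewrite -exprM mulnC exprM; congr (_ ^+ _); ring.
have xx : (2 ^+ j * d) ^+ 2 <= x ^+ 2.
  by rewrite x2 ler_pXn2r// ?nnegrE// mulr_ge0// ltW.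
rewrite (exprS (4 : R) j) e4 -mulrA invfM mulrA divff// mul1r ler_pdivrMr// mulrC.
rewrite ler_pdivlMr; last by rewrite mulr_gt0// exprn_gt0.
move: xx; rewrite exprMn; have := sqr_ge0 d; nra.
Qed.

(** Dyadic layer [j] contributes [a j * (2 * rho j * M) = 8 * M / 2 ^ j], and the geometric sum is
    at most 2, whence 16. *)
Lemma poisson_maximal_le h t d M : 0 < d -> measurable_fun setT h ->
  (forall s, 0 <= h s) ->
  (forall rho, 0 < rho -> (\int[mu]_(s in ball t rho) (h s)%:E <= (2 * rho * M)%:E)%E) ->
  (\int[mu]_(s in `[(t - pi)%R, (t + pi)%R]) (d / (d ^+ 2 + (s - t) ^+ 2) * h s)%:E
    <= (16 * M)%:E)%E.
Proof.
move=> d0 mh h0 hM.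
have M0 : 0 <= M.
  have h1 : (0 <= \int[mu]_(s in ball t 1) (h s)%:E)%E.
    by apply: integral_ge0 => s _; rewrite lee_fin.
  by have := le_trans h1 (hM 1 ltr01); rewrite lee_fin; lra.
pose J := Num.bound (pi / d : R).
have piJ : pi < 2 ^+ J * d.
  rewrite -ltr_pdivrMr//.
  have := archi_boundP (divr_ge0 (pi_ge0 R) (ltW d0)) => /lt_trans; apply.
  by rewrite -natrX ltr_nat ltn_expl.
pose a j : R := 4 / (4 ^+ j * d); pose rho j : R := 2 ^+ j * d.
have a0 j : 0 <= a j by rewrite divr_ge0// mulr_ge0 ?exprn_ge0 ?ltW.
have rho0 j : 0 < rho j by rewrite mulr_gt0// exprn_gt0.
pose w j s := (h \_ (ball t (rho j))) s.
have w0 j s : 0 <= w j s by rewrite /w patchE; case: ifP.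
have mw j : measurable_fun setT (w j).
  apply/(measurable_restrictT _ _).1; first exact: measurable_ball.
  exact: measurable_funTS.
have mball j : measurable (ball t (rho j) : set (measurableTypeR R)) := measurable_ball t (rho j).
have mk : measurable_fun setT (fun s => d / (d ^+ 2 + (s - t) ^+ 2) * h s).
  by apply: measurable_funM => //; apply: continuous_measurable_fun; exact: poisson_kernel_cts.
have k0 s : 0 <= d / (d ^+ 2 + (s - t) ^+ 2).
  by apply: divr_ge0; [exact: ltW|apply: addr_ge0; exact: sqr_ge0].
have maw j : measurable_fun setT (fun s => (a j * w j s)%:E).
  by apply/measurable_EFinP; apply: measurable_funM => //; exact: measurable_cst.
have mI : measurable (`[t - pi, t + pi]%classic : set (measurableTypeR R)) := measurable_itv _.
have msum : measurable_fun setT (fun s => (\sum_(j < J.+1) (a j * w j s)%:E)%E).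
  by exact: (@emeasurable_sum _ _ _ _ _ _ (fun (j : 'I_J.+1) s => (a j * w j s)%:E) (fun j => maw j)).
apply: (@le_trans _ _ (\int[mu]_(s in `[(t - pi)%R, (t + pi)%R]) (\sum_(j < J.+1) (a j * w j s)%:E))%E).
  apply: ge0_le_integral => //.
  - by move=> s _; rewrite lee_fin mulr_ge0.
  - by apply/measurable_EFinP; exact: measurable_funTS mk.
  - exact: measurable_funTS msum.
  move=> s /=; rewrite in_itv/= => /andP[s1 s2].
  have [j xj kj] := dyadic_layer (s - t) d0.
  have [jJ|Jj] := leqP j J.
    rewrite sumEFin lee_fin (bigD1 (Ordinal (jJ : (j < J.+1)%N)))//=.
    apply: ler_wpDr; first by apply: sumr_ge0 => i _; rewrite mulr_ge0.
    rewrite /w patchE (_ : s \in _); last by apply/mem_set; rewrite /ball/= distrC.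
    by rewrite ler_wpM2r.
  (* A layer beyond [J] is replaced by layer [J]: its weight is larger and, since [2 ^+ J * d > pi],
     its ball covers the whole interval. *)
  have kJ : d / (d ^+ 2 + (s - t) ^+ 2) <= a J.
    apply: (le_trans kj); rewrite ler_wpM2l// lef_pV2 ?posrE ?mulr_gt0 ?exprn_gt0//.
    apply: ler_wpM2r; first exact: ltW.
    by apply: ler_weXn2l; [rewrite ler1n|exact: ltnW].
  rewrite sumEFin lee_fin (bigD1 (Ordinal (ltnSn J)))//=.
  apply: ler_wpDr; first by apply: sumr_ge0 => i _; rewrite mulr_ge0.
  rewrite /w patchE (_ : s \in _); last first.
    apply/mem_set; rewrite /ball/= (le_lt_trans _ piJ)// ler_norml.
    by move: s1 s2; lra.
  by rewrite ler_wpM2r.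
apply: (@le_trans _ _ (\int[mu]_s (\sum_(j < J.+1) (a j * w j s)%:E))%E).
  apply: ge0_subset_integral; [exact: mI|exact: measurableT|exact: msum| |by []].
  by move=> s _; apply: sume_ge0 => j _; rewrite lee_fin mulr_ge0.
rewrite ge0_integral_sum; [|exact: measurableT|by move=> j; exact: maw|
  by move=> j s _; rewrite lee_fin mulr_ge0].
have wI j : (\int[mu]_s (a j * w j s)%:E <= (a j * (2 * rho j * M))%:E)%E.
  under eq_integral do rewrite EFinM.
  rewrite ge0_integralZl_EFin; [|exact: measurableT|by move=> s _; rewrite lee_fin|
    by apply/measurable_EFinP; exact: mw|exact: a0].
  rewrite [leRHS]EFinM; apply: lee_wpmul2l; first by rewrite lee_fin.
  apply: le_trans (hM _ (rho0 j)).
  by rewrite [leRHS]integral_mkcond restrict_EFin; exact: lexx.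
apply: (le_trans (lee_sum _ (fun j _ => wI (nat_of_ord j)))).
rewrite sumEFin lee_fin.
have E j : a j * (2 * rho j * M) = 8 * M * (1 / 2) ^+ j.
  have e4 : 4 ^+ j = 2 ^+ j ^+ 2 :> R by rewrite -exprM mulnC exprM; congr (_ ^+ _); ring.
  rewrite /a /rho e4 expr_div_n expr1n; field.
  by rewrite gt_eqF// gt_eqF// exprn_gt0.
under eq_bigr do rewrite E.
rewrite -mulr_sumr; have := sum_geometric_half J.+1.
have : 0 <= 8 * M by rewrite mulr_ge0.
nra.
Qed.

Lemma HL_maximal_ball h t M rho : (HL_maximal h t <= M%:E)%E -> 0 < rho ->
  (\int[mu]_(s in ball t rho) `|(h s)%:E| <= (2 * rho * M)%:E)%E.
Proof.
move=> hM r0.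
have : (iavg h (ball t rho) <= M%:E)%E.
  apply: le_trans hM; apply: ereal_sup_ubound => /=; exists rho => //.
  by rewrite in_itv/= andbT.
rewrite /iavg (lebesgue_measure_ball _ (ltW r0)) inver mulrn_eq0//= gt_eqF// => hh.
have r20 : 0 < rho *+ 2 by rewrite mulrn_wgt0.
have e2 : rho *+ 2 * M = 2 * rho * M by rewrite mulr2n; ring.
by move: hh; rewrite lee_pdivrMl// -EFinM e2.
Qed.

(** Stands in for Cauchy-Schwarz: it bounds a first moment by a second moment, with [eta] free to be
    tuned to the size of the latter. *)
Lemma half_amgm (x eta : R) : 0 < eta -> x <= eta / 2 * 1 + 1 / (2 * eta) * x ^+ 2.
Proof.
move=> eta0; rewrite -subr_ge0.
have -> : eta / 2 * 1 + 1 / (2 * eta) * x ^+ 2 - x = (eta - x) ^+ 2 / (2 * eta).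
  by field; rewrite gt_eqF.
by rewrite divr_ge0 ?sqr_ge0// mulr_ge0// ltW.
Qed.

(** Constants only: [3 / (lam / b)] comes from the maximal inequality at level [lam / b], and
    [4 * w - - (2 * w)] is the length of [[- 2 pi, 4 pi]] at [w = pi]. *)
Lemma maximal_arith (w lam eta S I b : R) : 0 < b -> 0 < lam -> 0 < eta ->
  I <= eta / 2 * (1 * (4 * w - - (2 * w))) +
    1 / (2 * eta) * ((4 * w - - (2 * w)) * S) ->
  3 / (lam / b) * I <= 9 * b * w / lam * (eta + S / eta).
Proof.
move=> b0 lam0 eta0 hI; have c0 : 0 < 3 * b / lam.
  by apply: divr_gt0; [apply: mulr_gt0; [rewrite ltr0n|exact: b0]|exact: lam0].
have -> : 3 / (lam / b) = 3 * b / lam.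
  by field; apply/andP; split; rewrite gt_eqF.
have -> : 9 * b * w / lam * (eta + S / eta) = 3 * b / lam *
    (eta / 2 * (1 * (4 * w - - (2 * w))) + 1 / (2 * eta) * ((4 * w - - (2 * w)) * S)).
  by field; apply/andP; split; rewrite gt_eqF.
by apply: ler_wpM2l; [exact: ltW|exact: hI].
Qed.

Lemma tpoly_maximal N (c : nat -> R[i]) (lam : R) : 0 < lam ->
  exists A : set R, [/\ measurable A,
    forall t r, 0 <= t <= 2 * pi -> 1 / 2 <= r < 1 ->
      lam < normc (\sum_(l < N) c l * (r%:C * expi t) ^+ l) -> A t
  & forall eta : R, 0 < eta -> (mu A <=
      (9 * 256 * pi / lam * (eta + (\sum_(l < N) normc (c l) ^+ 2) / eta))%:E)%E].
Proof.
move=> lam0.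
have pi0 : 0 < pi :> R := pi_gt0 R; have pi2 : 2 <= pi :> R := pi_ge2 R.
(* Cutting off to three periods makes [p] integrable, while [D] still contains [[t - pi, t + pi]]
   for every [t] in [[0, 2 pi]]. *)
pose D : set (measurableTypeR R) := `[- (2 * pi), 4 * pi]%classic.
pose p t := normc (tpoly N c t); pose h := p \_ D.
have pc : continuous p by exact: continuous_normc_tpoly.
have ip : mu.-integrable D (EFin \o p) by exact: continuous_itv_integrable.
have mD : measurable D by exact: measurable_itv.
have lh : locally_integrable setT h.
  exact: integrable_locally_restrict (measurable_itv _) ip.
have mh : measurable_fun setT h by case: lh.
have p0 t : 0 <= p t by exact: normc_ge0.
have h0 t : 0 <= h t by rewrite /h patchE; case: ifP.
(* If the maximal function were at most [M] at [t], the constants 64 and 16 would give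
   [2 pi X <= 1024 M = 4 lam] for the modulus [X] at radius [r], so [X <= lam] because [pi >= 2]. *)
pose M := lam / 256; have M0 : 0 < M by rewrite divr_gt0.
exists [set x | (HL_maximal h x > M%:E)%E]; split.
- rewrite -[X in measurable X]setTI; apply: emeasurable_fun_o_infty => //.
  exact: measurable_HL_maximal.
- move=> t r /andP[t0 t2] r21 lt /=; rewrite ltNge; apply/negP => hM.
  have r1 : 0 < 1 - r by case/andP: r21 => _; rewrite subr_gt0.
  have hb rho : 0 < rho -> (\int[mu]_(s in ball t rho) (h s)%:E <= (2 * rho * M)%:E)%E.
    move=> rho0; have := HL_maximal_ball hM rho0.
    by under eq_integral do rewrite abse_EFin ger0_norm//.
  have := poisson_maximal_le r1 mh h0 hb.
  have kc : continuous (fun s : R => (1 - r) / ((1 - r) ^+ 2 + (s - t) ^+ 2) * p s).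
    by move=> s; apply: cvgM; [exact: poisson_kernel_cts|exact: pc].
  have ki := continuous_itv_integrable (t - pi) (t + pi) kc.
  have -> : (\int[mu]_(s in `[(t - pi)%R, (t + pi)%R])
      ((1 - r) / ((1 - r) ^+ 2 + (s - t) ^+ 2) * h s)%:E =
    \int[mu]_(s in `[(t - pi)%R, (t + pi)%R])
      ((1 - r) / ((1 - r) ^+ 2 + (s - t) ^+ 2) * p s)%:E)%E.
    apply: eq_integral => s /set_mem/=; rewrite in_itv/= => /andP[s1 s2].
    rewrite /h patchE (_ : s \in D)//; apply/mem_set; rewrite /D/= in_itv/=.
    by move: s1 s2 t0 t2; lra.
  have mI : measurable (`[t - pi, t + pi]%classic : set (measurableTypeR R)) := measurable_itv _.
  rewrite -(fineK (integrable_fin_num mI ki)) lee_fin.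
  have := tpoly_poisson N c t r21; rewrite -/(p _).
  set I := \int[mu]_(s in _) _; set X := normc _ in lt *; set I' := fine _.
  have -> : I' = I by [].
  move=> h1 h2; have : 2 * pi * X <= 1024 * M by lra.
  by rewrite /M; nra.
- move=> eta eta0; apply: (le_trans (maximal_inequality lh M0)).
  have -> : (\int[mu]_y `|(h y)%:E| = \int[mu]_(y in D) (p y)%:E)%E.
    rewrite [RHS]integral_mkcond restrict_EFin; apply: eq_integral => y _.
    by rewrite abse_EFin ger0_norm.
  rewrite -(fineK (integrable_fin_num mD ip)) -EFinM lee_fin.
  have p2c : continuous (fun s => p s ^+ 2) by move=> s; apply: cvg_sqr; exact: pc.
  have p2i : mu.-integrable D (EFin \o (fun s => p s ^+ 2)) by exact: continuous_itv_integrable.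
  have ci : mu.-integrable D (EFin \o (fun=> 1)).
    by apply: continuous_itv_integrable => s; exact: cvg_cst.
  have [Hi HE] := integrable_comb (eta / 2) (1 / (2 * eta)) mD ci p2i.
  have l1 : \int[mu]_(y in D) p y <= \int[mu]_(y in D) (eta / 2 * 1 + 1 / (2 * eta) * p y ^+ 2).
    by apply: le_Rintegral => // y _; exact: half_amgm.
  have ab : - (2 * pi) < 4 * pi :> R.
    by apply: (@lt_trans _ _ (0 : R)); rewrite ?oppr_lt0; apply: mulr_gt0; rewrite ?ltr0n.
  have pab : expi (- (2 * pi)) = expi (4 * pi) :> R[i].
    rewrite expiN expi_pi2 conjc1 (_ : 4 * pi = 2 * pi + 2 * pi); last by ring.
    by rewrite expiD expi_pi2 mulr1.
  have muD : mu D = (4 * pi - - (2 * pi))%:E.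
    by rewrite /D lebesgue_measure_itv/= lte_fin ab.
  have := l1; rewrite HE (Rintegral_tpoly_sqr ab pab N c) Rintegral_cst//.
  have muD' : fine (mu D) = 4 * pi - - (2 * pi) by rewrite muD.
  rewrite muD'.
  by move=> h1; exact: (maximal_arith (b := 256) (ltr0n R 256) lam0 eta0 h1).
Qed.

End maximal_function.

(** * Almost everywhere Cauchy behaviour along radii *)

Section fatou_theorem.
Context {R : realType}.
Local Notation mu := (@lebesgue_measure R).
Implicit Types (t s r M lam : R) (c : nat -> R[i]).

Lemma cvg_real_complex (T : Type) (F : set_system T) {FF : ProperFilter F}
  (f : T -> R) (x : R) : f @ F --> x -> (f t)%:C @[t --> F] --> (x%:C : R[i]).
Proof.
move=> /cvgrPdist_lt fx; apply/cvgC_normP/cvgrPdist_lt => e e0.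
by have := fx _ e0; apply: filterS => t; rewrite dist0_normc -rmorphB normc_real distrC.
Qed.

Definition radial c r t : R[i] := pser c (r%:C * expi t).

Lemma normc_radial r t : 0 <= r -> normc (r%:C * expi t : R[i]) = r.
Proof. by move=> r0; rewrite normcM normc_expi mulr1 normc_real ger0_norm. Qed.

(** Partial sums converging to a value above [lam] in modulus eventually exceed [lam], so the lower
    limit of the exceptional sets of the partial sums works; its measure is a limit along an
    increasing union. *)
Lemma nsq_maximal c s lam eta : is_nsq c s -> 0 < lam -> 0 < eta ->
  exists A : set R, [/\ measurable A,
    forall t r, 0 <= t <= 2 * pi -> 1 / 2 <= r < 1 -> lam < normc (radial c r t) -> A t
  & (mu A <= (9 * 256 * pi / lam * (eta + s / eta))%:E)%E].
Proof.
move=> cs lam0 eta0.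
have /choice[A AP] := fun N => tpoly_maximal N c lam0.
have mA N : measurable (A N) by case: (AP N).
pose F n := \bigcap_k A (n + k)%N.
have mF n : measurable (F n) by apply: bigcapT_measurable.
exists (\bigcup_n F n); split; first exact: bigcupT_measurable.
- move=> t r t01 /[dup] r21 /andP[r2 r1] lr.
  have r0 : 0 <= r by lra.
  have z1 : normc (r%:C * expi t : R[i]) < 1 by rewrite normc_radial.
  have cn : normc (series (fun l => c l * (r%:C * expi t) ^+ l) n) @[n --> \oo] -->
      normc (radial c r t).
    by apply: cvgC_norm; exact: pser_cvg (nsq_bounded cs) z1.
  have d0 : 0 < normc (radial c r t) - lam by rewrite subr_gt0.
  move: cn => /cvgrPdist_lt/(_ _ d0)[n _ nP]; exists n => // k _.
  have [_ + _] := AP (n + k)%N; apply; [exact: t01|exact: r21|].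
  have := nP (n + k)%N (leq_addr _ _); rewrite /series/= big_mkord -/(radial c r t).
  by move=> /(le_lt_trans (ler_norm _)); lra.
- have cF : (mu \o F) @ \oo --> mu (\bigcup_n F n).
    apply: nondecreasing_cvg_mu => //; first exact: bigcupT_measurable.
    apply/nondecreasing_seqP => n; apply/subsetPset => t Ft k _.
    by have := Ft k.+1 I; rewrite addnS addSn.
  have <- : limn (mu \o F) = mu (\bigcup_n F n) by apply/cvg_lim.
  apply: lime_le; first by apply/cvg_ex; exists (mu (\bigcup_n F n)).
  apply: nearW => n; apply: (@le_trans _ _ (mu (A n))).
    apply: le_measure; rewrite ?inE; [exact: mF|exact: mA|].
    by move=> t /(_ 0%N I); rewrite addn0.
  have [_ _ /(_ _ eta0) h] := AP n; apply: (le_trans h); rewrite lee_fin.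
  have pi0 : 0 < pi :> R := pi_gt0 R.
  apply: ler_wpM2l.
    by apply: divr_ge0; [apply: mulr_ge0; [apply: mulr_ge0; exact: ler0n|exact: ltW]|exact: ltW].
  rewrite lerD2l; apply: ler_wpM2r; first by rewrite invr_ge0; exact: ltW.
  by have := series_nsq_le n cs; rewrite /series/= big_mkord.
Qed.

Definition oscillates c lam t := forall rho, rho < 1 ->
  exists r r', [/\ rho < r < 1, rho < r' < 1 & lam < normc (radial c r t - radial c r' t)].

Lemma three_halves_le (x : R) : x + x + (x / 2 + x / 2) <= 3 * x.
Proof. lra. Qed.

(** Subtracting a polynomial, continuous up to the circle, does not remove the oscillation. Of
    [3 * lam] the polynomial absorbs at most [lam] near radius 1, so the tail exceeds [lam] at one
    of the two radii. *)
Lemma oscillates_maximal c s lam N t : is_nsq c s -> 0 < lam ->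
  oscillates c (3 * lam) t ->
  exists2 r, 1 / 2 <= r < 1 & lam < normc (radial (tail_coef N c) r t).
Proof.
move=> cs lam0 osc; pose q r := \sum_(l < N) c l * (r%:C * expi t) ^+ l.
have qc : q r @[r --> (1 : R)] --> q 1.
  rewrite /q; apply: (@cvg_sum_ord _ R[i] _ _ (nbhs_filter (1 : R)) N
    (fun l r => c l * (r%:C * expi t) ^+ l) (fun l => c l * (1%:C * expi t) ^+ l)) => l.
  apply: cvgM; first exact: cvg_cst.
  have c1 : r%:C * expi t @[r --> (1 : R)] --> (1%:C * expi t : R[i]).
    apply: cvgM; last exact: cvg_cst.
    by apply: (@cvg_real_complex _ _ (nbhs_pfilter (1 : R))); exact: cvg_id.
  elim: l => [|l IH]; first by under eq_fun do rewrite expr0; exact: cvg_cst.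
  under eq_fun do rewrite exprS; rewrite exprS.
  by apply: cvgM; [exact: c1|exact: IH].
have /(@cvgC_normP _ _ _ (nbhs_pfilter (1 : R)))/cvg0_normcP/(_ _ (divr_gt0 lam0 (ltr0n _ 2))) := qc.
move=> /nbhs_ballP[d /= d0 dP].
pose rho := Num.max (1 / 2) (1 - d).
have rho1 : rho < 1 by rewrite gt_max; apply/andP; split; lra.
have [r [r' [/andP[r0 r1] /andP[r0' r1'] rr]]] := osc _ rho1.
have qd x : rho < x -> x < 1 -> normc (q x - q 1) < lam / 2.
  rewrite gt_max => /andP[x1 x2] x3; apply: dP; rewrite /ball/= ger0_norm; lra.
have x12 x : rho < x -> 1 / 2 <= x by rewrite gt_max => /andP[/ltW].
have rE x : rho < x -> x < 1 -> radial (tail_coef N c) x t = radial c x t - q x.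
  move=> x1 x2; have x0 : 0 <= x by have := x12 _ x1; lra.
  by rewrite /radial (@pser_tail _ _ _ _ N (nsq_bounded cs))// normc_radial.
have dich (X : R) : lam < X \/ X <= lam by case: (ltP lam X); [left|right].
case: (dich (normc (radial (tail_coef N c) r t))) => h.
  by exists r; [rewrite (x12 _ r0) r1|exact: h].
exists r'; first by rewrite (x12 _ r0') r1'.
rewrite ltNge; apply/negP => h'.
have : normc (radial c r t - radial c r' t) <= lam + lam + (lam / 2 + lam / 2).
  have -> : radial c r t - radial c r' t = (radial (tail_coef N c) r t -
      radial (tail_coef N c) r' t) + ((q r - q 1) - (q r' - q 1)).
    have alg (u v p p' w : R[i]) : u - v = (u - p) - (v - p') + ((p - w) - (p' - w)).
      by ring.
    by rewrite (rE _ r0 r1) (rE _ r0' r1'); exact: alg.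
  apply: le_trans (normc_triangle _ _) _; apply: lerD.
    by apply: le_trans (normc_triangleB _ _) _; apply: lerD; [exact: h|exact: h'].
  apply: le_trans (normc_triangleB _ _) _.
  by apply: lerD; apply: ltW; apply: qd.
move=> hle; have := lt_le_trans rr (le_trans hle (three_halves_le lam)).
by rewrite ltxx.
Qed.

Lemma half_split (x C : R) : 0 < C -> C * (x / (2 * C) + x / (2 * C)) = x.
Proof. by move=> C0; field; rewrite gt_eqF. Qed.

(** Dropping enough terms leaves a tail of squared norm below [eta ^+ 2], for which the bound of
    [nsq_maximal] is at most [2 * C * eta], arbitrarily small. *)
Lemma oscillates_negligible c s lam : is_nsq c s -> 0 < lam ->
  mu.-negligible [set t | 0 <= t <= 2 * pi /\ oscillates c (3 * lam) t].
Proof.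
move=> cs lam0; have pi0 : 0 < pi :> R := pi_gt0 R.
have /choice[A AP] : forall n : nat, exists A : set R, [/\ measurable A,
    [set t | 0 <= t <= 2 * pi /\ oscillates c (3 * lam) t] `<=` A &
    (mu A <= (n.+1%:R^-1)%:E)%E].
  move=> n.
  have [C C0 CE] : exists2 C : R, 0 < C & 9 * 256 * pi / lam = C.
    exists (9 * 256 * pi / lam); last by [].
    by apply: divr_gt0; [apply: mulr_gt0; [apply: mulr_gt0; rewrite ltr0n|exact: pi0]|exact: lam0].
  have n0 : 0 < n.+1%:R^-1 :> R by rewrite invr_gt0 ltr0n.
  have C20 : 0 < 2 * C by apply: mulr_gt0; [rewrite ltr0n|exact: C0].
  have [eta eta0 etaE] : exists2 eta : R, 0 < eta & C * (eta + eta) = n.+1%:R^-1.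
    by exists (n.+1%:R^-1 / (2 * C)); [exact: divr_gt0|exact: half_split].
  have e2 : 0 < eta ^+ 2 by rewrite exprn_gt0.
  have [N sN] := nsq_tail_lt cs e2.
  have [A [mA AP mu_A]] := nsq_maximal (@nsq_tail _ _ _ N cs) lam0 eta0.
  exists A; split => //.
    move=> t [t01 osc]; have [r r12 lr] := oscillates_maximal N cs lam0 osc.
    exact: (AP t r).
  apply: (le_trans mu_A); rewrite lee_fin CE -etaE.
  apply: ler_wpM2l; first exact: ltW.
  by rewrite lerD2l ler_pdivrMr// -expr2 ltW.
have mA n : measurable (A n) by case: (AP n).
have mB : measurable (\bigcap_n A n) by exact: bigcapT_measurable.
exists (\bigcap_n A n); split=> //; last first.
  by move=> t ht n _; case: (AP n) => _ /(_ _ ht).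
apply/eqP; rewrite eq_le measure_ge0 andbT; apply/lee_addgt0Pr => e e0; rewrite add0e.
have [n _ /(_ n (leqnn n)) /= nP] := near_infty_natSinv_lt (PosNum e0).
apply: (@le_trans _ _ (mu (A n))); first by apply: le_measure; rewrite ?inE; [exact: mB|exact: mA|move=> t /(_ n I)].
have [_ _ h] := AP n; apply: (le_trans h); rewrite lee_fin ltW//.
Qed.

(** Applied to partial sums at a fixed radius, with [N] empty, and to radii tending to 1, with [N]
    the divergence set. *)
Lemma fatou_bound (D N : set (measurableTypeR R)) (phi : nat -> R -> R) (psi : R -> R) (B : R) :
  measurable D -> measurable N -> mu N = 0%E ->
  (forall n, measurable_fun D (phi n)) -> (forall n t, 0 <= phi n t) ->
  measurable_fun D psi -> (forall t, 0 <= psi t) ->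
  (forall n, (\int[mu]_(t in D) (phi n t)%:E <= B%:E)%E) ->
  (forall t, D t -> ~ N t -> phi n t @[n --> \oo] --> psi t) ->
  (\int[mu]_(t in D) (psi t)%:E <= B%:E)%E.
Proof.
move=> mD mN N0 mphi phi0 mpsi psi0 phiB cv.
have mDN : measurable (D `\` N) by exact: measurableD.
rewrite (@ge0_negligible_integral _ _ _ mu D N)//; last 2 first.
- exact/measurable_EFinP.
- by move=> t _; rewrite lee_fin.
have -> : (\int[mu]_(t in D `\` N) (psi t)%:E =
    \int[mu]_(t in D `\` N) limn_einf (fun n => (phi n t)%:E))%E.
  apply: eq_integral => t /set_mem[Dt Nt]; have h : (phi n t)%:E @[n --> \oo] --> (psi t)%:E.
    by apply: cvg_EFin; [exact: nearW|exact: cv].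
  by rewrite (cvg_limn_einf_sup h).1.
apply: (@le_trans _ _ (limn_einf (fun n => \int[mu]_(t in D `\` N) (phi n t)%:E)%E)).
  apply: (@fatou _ _ _ mu _ mDN (fun n t => (phi n t)%:E)).
  - by move=> n; apply/measurable_EFinP; apply: measurable_funS (mphi n).
  - by move=> n t _; rewrite lee_fin.
rewrite limn_einf_lim; apply: lime_le; first exact: is_cvg_einfs.
apply: nearW => n; apply: (@le_trans _ _ (\int[mu]_(t in D `\` N) (phi n t)%:E)%E).
  by apply: ereal_inf_lbound; exists n => /=.
apply: le_trans (phiB n); apply: ge0_subset_integral => //.
- exact/measurable_EFinP.
- by move=> t _; rewrite lee_fin.
Qed.

Lemma radial_cts_angle c s r : is_nsq c s -> 0 <= r < 1 ->
  forall t, radial c r u @[u --> t] --> radial c r t.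
Proof.
move=> cs /andP[r0 r1] t.
have z1 : normc (r%:C * expi t : R[i]) < 1 by rewrite normc_radial.
have h : r%:C * expi u @[u --> t] --> (r%:C * expi t : R[i]).
  by apply: cvgM; [exact: cvg_cst|exact: cvg_expi].
exact: (@cvg_comp _ _ _ (fun u => r%:C * expi u) (pser c) _ _ _ h (pser_continuous (nsq_bounded cs) z1)).
Qed.

Lemma radial_cts c s r t : is_nsq c s -> 0 <= r < 1 ->
  radial c x t @[x --> r] --> radial c r t.
Proof.
move=> cs /andP[r0 r1].
have z1 : normc (r%:C * expi t : R[i]) < 1 by rewrite normc_radial.
have h : x%:C * expi t @[x --> r] --> (r%:C * expi t : R[i]).
  apply: cvgM; last exact: cvg_cst.
  by apply: (@cvg_real_complex _ _ (nbhs_pfilter r)); exact: cvg_id.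
exact: (@cvg_comp _ _ _ (fun x : R => x%:C * expi t) (pser c) _ _ _ h (pser_continuous (nsq_bounded cs) z1)).
Qed.

Lemma radial_sqr_integral_le c s r : is_nsq c s -> 0 <= r < 1 ->
  (\int[mu]_(t in `[0%R, (2 * pi)%R]) (normc (radial c r t) ^+ 2)%:E <= (2 * pi * s)%:E)%E.
Proof.
move=> cs /[dup] r01 /andP[r0 r1]; have pi0 : 0 < pi :> R := pi_gt0 R.
pose cr l := c l * r%:C ^+ l.
have mI : measurable (`[0, 2 * pi]%classic : set (measurableTypeR R)) := measurable_itv _.
have cts (f : R -> R) : continuous f -> measurable_fun (`[0, 2 * pi]%classic : set (measurableTypeR R)) f.
  by move=> cf; apply: measurable_funTS; exact: continuous_measurable_fun.
apply: (@fatou_bound _ set0 (fun N t => normc (tpoly N cr t) ^+ 2)).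
- exact: mI.
- exact: measurable0.
- exact: measure0.
- by move=> N; apply: cts => t; apply: cvg_sqr; exact: continuous_normc_tpoly.
- by move=> N t; exact: sqr_ge0.
- apply: cts => t; apply: cvg_sqr.
  exact: (@cvgC_norm _ _ _ (nbhs_pfilter t) _ _ (radial_cts_angle cs r01 (t:=t))).
- by move=> t; exact: sqr_ge0.
- move=> N; have ab : 0 < 2 * pi :> R by lra.
  have pab : expi 0 = expi (2 * pi) :> R[i] by rewrite expi0 expi_pi2.
  have i2 : mu.-integrable `[0, 2 * pi] (EFin \o (fun t => normc (tpoly N cr t) ^+ 2)).
    by apply: continuous_itv_integrable => t; apply: cvg_sqr; exact: continuous_normc_tpoly.
  rewrite -(fineK (integrable_fin_num mI i2)) lee_fin.
  have := Rintegral_tpoly_sqr ab pab N cr; rewrite /Rintegral => ->.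
  rewrite subr0; apply: ler_wpM2l; [exact: ltW|apply: le_trans (series_nsq_le N cs)].
  rewrite /series/= big_mkord; apply: ler_sum => l _.
  rewrite /cr normcM normc_exp normc_real ger0_norm// exprMn ler_piMr ?sqr_ge0//.
  by rewrite exprn_ile1 ?exprn_ge0// exprn_ile1// ltW.
- move=> t _ _; apply: cvg_sqr.
  have z1 : normc (r%:C * expi t : R[i]) < 1 by rewrite normc_radial.
  have : normc (series (fun l => c l * (r%:C * expi t) ^+ l) n) @[n --> \oo] -->
      normc (radial c r t).
    by apply: cvgC_norm; exact: pser_cvg (nsq_bounded cs) z1.
  rewrite (_ : (fun n => normc (series _ n)) = fun N => normc (tpoly N cr t))//.
  apply/funext => N; rewrite /series/= big_mkord /tpoly; congr normc.
  by apply: eq_bigr => l _; rewrite /cr exprMn; ring.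
Qed.

End fatou_theorem.

(** * Measurability and mean-square control of boundary values *)

Section boundary_values.
Context {R : realType}.
Local Notation mu := (@lebesgue_measure R).
Implicit Types (t r : R).

Local Notation circle := (`[0, 2 * pi]%classic : set (measurableTypeR R)).

Let mI : measurable circle := measurable_itv _.

Lemma complex_cauchy_left (g : R -> R[i]) :
  (forall e : R, 0 < e -> exists2 rho, rho < 1 & forall r r', rho < r < 1 ->
     rho < r' < 1 -> normc (g r - g r') < e) ->
  exists l : R[i], g r @[r --> (1 : R)^'-] --> l.
Proof.
move=> gC.
have key (p : R[i] -> R) : (forall z w, `|p z - p w| <= normc (z - w)) ->
    cvg (p (g r) @[r --> (1 : R)^'-]).
  move=> pn; apply: cauchy_cvg; apply: cauchy_exP => e e0.
  have [rho rho1 gr] := gC e e0.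
  have m1 : rho < (rho + 1) / 2 < 1 by apply/andP; split; lra.
  exists (p (g ((rho + 1) / 2))).
  have h : \forall r \near (1 : R)^'-, rho < r < 1.
    near=> r; apply/andP; split; near: r; first exact: nbhs_left_gt.
    exact: nbhs_left_lt.
  move: h; apply: filterS => r rr; rewrite /ball/=.
  by apply: le_lt_trans (pn _ _) _; exact: gr.
have cR : cvg (Re (g r) @[r --> (1 : R)^'-]).
  by apply: key => z w; rewrite -ReN -ReD; exact: normRe_le.
have cI : cvg (Im (g r) @[r --> (1 : R)^'-]).
  by apply: key => z w; rewrite -ImN -ImD; exact: normIm_le.
exists (lim (Re (g r) @[r --> (1 : R)^'-]) +i* lim (Im (g r) @[r --> (1 : R)^'-])).
by apply: cvgC_ReIm; [exact: cR|exact: cI].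
Unshelve. all: by end_near. Qed.

Lemma measurable_sqr_normc (D : set (measurableTypeR R)) (h : R -> R[i]) :
  measurable_fun D (fun t => Re (h t)) -> measurable_fun D (fun t => Im (h t)) ->
  measurable_fun D (fun t => normc (h t) ^+ 2).
Proof.
move=> mR mIm; rewrite (_ : (fun t => normc _ ^+ 2) = fun t => Re (h t) * Re (h t) + Im (h t) * Im (h t)).
  by apply: measurable_funD; apply: measurable_funM.
by apply/funext => t; rewrite sqr_normcE !expr2.
Qed.

Section one_function.
Variables (c : nat -> R[i]) (s : R).
Hypothesis cs : is_nsq c s.

(* Rational radii keep the divergence set measurable. *)
Definition divergence_cell (k m : nat) (p q : rat) : set (measurableTypeR R) :=
  [set t | [/\ 0 <= t <= 2 * pi, 1 - m.+1%:R^-1 < (ratr p : R) < 1,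
    1 - m.+1%:R^-1 < (ratr q : R) < 1 &
    k.+1%:R^-1 < normc (radial c (ratr p) t - radial c (ratr q) t)]].

Definition divergence_set : set (measurableTypeR R) :=
  \bigcup_k \bigcap_m \bigcup_p \bigcup_q divergence_cell k m p q.

Lemma measurable_divergence_set : measurable divergence_set.
Proof.
apply: bigcupT_measurable => k; apply: bigcapT_measurable => m.
apply: bigcupT_measurable_rat => p; apply: bigcupT_measurable_rat => q.
(* The bounds on the radii do not involve [t]: when they fail the cell is empty, otherwise only a
   strict inequality on a continuous function of [t] remains. *)
have [h|h] := pselect ((1 - m.+1%:R^-1 < (ratr p : R) < 1) /\ (1 - m.+1%:R^-1 < (ratr q : R) < 1)); last first.
  rewrite (_ : divergence_cell k m p q = set0); first exact: measurable0.
  by apply/seteqP; split => // t [_ h1 h2 _]; apply: h.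
case: h => hp hq.
have m1 : 0 <= 1 - m.+1%:R^-1 :> R by rewrite subr_ge0 invf_le1 ?ler1n ?ltr0n.
have p01 : 0 <= (ratr p : R) < 1.
  by case/andP: hp => h1 ->; rewrite andbT; apply: ltW; exact: le_lt_trans m1 h1.
have q01 : 0 <= (ratr q : R) < 1.
  by case/andP: hq => h1 ->; rewrite andbT; apply: ltW; exact: le_lt_trans m1 h1.
pose g t := normc (radial c (ratr p) t - radial c (ratr q) t).
have gc : continuous g.
  move=> t; have cp := radial_cts_angle cs p01 (t:=t).
  have cq := radial_cts_angle cs q01 (t:=t).
  exact: (@cvgC_norm _ _ _ (nbhs_pfilter t) _ _ (cvgB cp cq)).
rewrite (_ : divergence_cell k m p q = circle `&` (g @^-1` `]k.+1%:R^-1, +oo[)).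
  apply: measurableI; first exact: mI.
  have := continuous_measurable_fun gc measurableT (measurable_itv `]k.+1%:R^-1, +oo[).
  by rewrite setTI.
apply/seteqP; split => t.
  by move=> [t01 _ _ h]; split => /=; rewrite in_itv/= ?andbT.
by move=> [] /=; rewrite !in_itv/= andbT.
Qed.

Lemma divergence_set_measure0 : mu divergence_set = 0%E.
Proof.
apply: measure_negligible; first exact: measurable_divergence_set.
have k0 (k : nat) : 0 < k.+1%:R^-1 / 3 :> R by rewrite divr_gt0// invr_gt0 ltr0n.
apply: (negligibleS _ (negligible_bigcup (fun k => oscillates_negligible cs (k0 k)))).
move=> t [k _ kP]; exists k => //; split.
  by have [p _ [q _ [? _ _ _]]] := kP 0%N I.
move=> rho rho1; have d0 : 0 < 1 - rho by rewrite subr_gt0.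
have [m _ /(_ m (leqnn m)) /= mP] := near_infty_natSinv_lt (PosNum d0).
have [p _ [q _ [_ /andP[p1 p2] /andP[q1 q2] pq]]] := kP m I.
have mP' : m.+1%:R^-1 < 1 - rho := mP.
have rm : rho < 1 - m.+1%:R^-1 by rewrite ltrBrDr -ltrBrDl.
exists (ratr p), (ratr q); split.
- by rewrite (lt_trans rm p1).
- by rewrite (lt_trans rm q1).
- by rewrite mulrC divfK// pnatr_eq0.
Qed.

Lemma rational_radius r t rho e : 0 <= rho -> rho < r < 1 -> 0 < e ->
  exists2 p : rat, rho < (ratr p : R) < 1 & normc (radial c (ratr p) t - radial c r t) < e.
Proof.
move=> rho0 /andP[r1 r2] e0.
have r01 : 0 <= r < 1 by rewrite r2 andbT; apply: ltW; exact: le_lt_trans rho0 r1.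
have := @radial_cts _ _ _ r t cs r01.
move=> /(@cvgC_normP _ _ _ (nbhs_pfilter r))/cvg0_normcP/(_ _ e0).
move=> /nbhs_ballP[d /= d0 dP].
have lo : Num.max rho (r - d) < r by rewrite gt_max r1 ltrBlDr ltrDl.
have [p] := rat_in_itvoo lo; rewrite in_itv/= gt_max => /andP[/andP[p1 p2] p3].
exists p; first by rewrite p1 (lt_trans p3).
by apply: dP; rewrite /ball/= ger0_norm; lra.
Qed.

Lemma quarter_lt (e k x y : R) : k < e / 4 -> x < e / 4 -> y < e / 4 -> 0 < e ->
  k + (x + y) < e.
Proof. by move=> *; lra. Qed.

(** Off the divergence set the Cauchy condition holds along rational radii; continuity in the radius
    carries it to all radii, at a cost of [e / 4] for each. *)
Lemma radial_cvg t : 0 <= t <= 2 * pi -> ~ divergence_set t ->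
  exists l : R[i], radial c r t @[r --> (1 : R)^'-] --> l.
Proof.
move=> t01 tD; apply: complex_cauchy_left => e e0.
have e4 : 0 < e / 4 by rewrite divr_gt0.
have [k _ /(_ k (leqnn k)) /= kP] := near_infty_natSinv_lt (PosNum e4).
have : ~ (\bigcap_m \bigcup_p \bigcup_q divergence_cell k m p q) t.
  by move=> h; apply: tD; exists k.
move=> /existsNP[m /not_implyP[_ mP]].
have m0 : 0 <= 1 - m.+1%:R^-1 :> R by rewrite subr_ge0 invf_le1 ?ler1n ?ltr0n.
exists (1 - m.+1%:R^-1); first by rewrite gtrBl invr_gt0 ltr0n.
move=> r r' hr hr'.
have [p hp np] := rational_radius t m0 hr e4.
have [q hq nq] := rational_radius t m0 hr' e4.
have pq : normc (radial c (ratr p) t - radial c (ratr q) t) <= k.+1%:R^-1.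
  rewrite leNgt; apply/negP => h; apply: mP; exists p => //; exists q => //.
have alg (u v u' v' : R[i]) : u - v = (u' - v') + ((v' - v) - (u' - u)) by ring.
rewrite (alg _ _ (radial c (ratr p) t) (radial c (ratr q) t)).
apply: le_lt_trans (normc_triangle _ _) _.
apply: le_lt_trans (lerD pq (normc_triangleB _ _)) _.
exact: (quarter_lt kP nq np e0).
Qed.

(** Makes [bdry] predictable on the divergence set: without a limit, [lim] returns the default
    [point], so [bdry] is constant there and measurable on the whole circle. *)
Lemma radial_dvg t : divergence_set t -> ~ exists l : R[i], radial c r t @[r --> (1 : R)^'-] --> l.
Proof.
move=> [k _ kP] [l /cvgC_normP/cvg0_normcP rl].
have k0 : 0 < k.+1%:R^-1 / 2 :> R by rewrite divr_gt0// invr_gt0 ltr0n.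
have [d /= d0 dP] := rl _ k0.
have [m _ /(_ m (leqnn m)) /= mP] := near_infty_natSinv_lt (PosNum d0).
have [p _ [q _ [_ /andP[p1 p2] /andP[q1 q2]]]] := kP m I.
have near1 x : 1 - m.+1%:R^-1 < x -> x < 1 -> normc (radial c x t - l) < k.+1%:R^-1 / 2.
  move=> x1 x2; apply: dP => //=; rewrite /ball_/= ger0_norm; last by rewrite subr_ge0 ltW.
  by apply: lt_trans mP; rewrite ltrBlDr -ltrBlDl.
have alg (u v w : R[i]) : u - v = (u - w) - (v - w) by ring.
apply/negP; rewrite -leNgt (alg _ _ l); apply: le_trans (normc_triangleB _ _) _.
have h1 := near1 _ p1 p2; have h2 := near1 _ q1 q2.
apply: (le_trans (lerD (ltW h1) (ltW h2))); apply: ler_of_eq.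
exact: esym (splitr _).
Qed.

Variable f : R[i] -> R[i].
Hypothesis fc : forall z, unit_disc z -> f z = pser c z.

Lemma near_left_radial t : \forall r \near (1 : R)^'-, f (r%:C * expi t) = radial c r t.
Proof.
have h : \forall r \near (1 : R)^'-, (0 : R) < r < 1.
  near=> r; apply/andP; split; near: r; first by apply: nbhs_left_gt.
  exact: nbhs_left_lt.
move: h; apply: filterS => r /andP[r0 r1]; apply: fc.
rewrite /unit_disc; change (normc (r%:C * expi t : R[i]) < 1).
by rewrite normc_radial; [exact: r1|exact: ltW].
Unshelve. all: by end_near. Qed.

Lemma bdry_radial t : 0 <= t <= 2 * pi -> ~ divergence_set t ->
  radial c r t @[r --> (1 : R)^'-] --> bdry f t.
Proof.
move=> t01 tD; have [l rl] := radial_cvg t01 tD.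
have fl : f (r%:C * expi t) @[r --> (1 : R)^'-] --> l.
  by apply: cvg_trans rl; apply: near_eq_cvg; apply: filterS (near_left_radial t) => r ->.
by rewrite /bdry (cvgC_lim fl).
Qed.

Lemma bdry_divergent t : divergence_set t -> bdry f t = point.
Proof.
move=> tD; rewrite /bdry dvgP// => /cvg_ex[l fl]; apply: (radial_dvg tD); exists l.
by apply: cvg_trans fl; apply: near_eq_cvg; apply: filterS (near_left_radial t) => r ->.
Qed.

Definition radius (n : nat) : R := 1 - n.+1%:R^-1.

Lemma radius01 n : 0 <= radius n < 1.
Proof. by rewrite /radius subr_ge0 invf_le1 ?ler1n ?ltr0n// gtrBl invr_gt0 ltr0n. Qed.

Lemma radius_cvg (g : R -> R[i]) (l : R[i]) : g r @[r --> (1 : R)^'-] --> l ->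
  g (radius n) @[n --> \oo] --> l.
Proof.
move=> gl; have u1 : radius @ \oo --> (1 : R).
  rewrite /radius -[X in _ --> X](subr0 (1 : R)); apply: cvgB; first exact: cvg_cst.
  exact: cvg_harmonic.
have ul n : radius n < 1 by case/andP: (radius01 n).
have hR : Re (g r) @[r --> (1 : R)^'-] --> Re l by exact: cvgC_Re gl.
have hI : Im (g r) @[r --> (1 : R)^'-] --> Im l by exact: cvgC_Im gl.
apply: cvgC_ReIm.
  by move/cvg_at_leftP: hR => /(_ radius (conj ul u1)).
by move/cvg_at_leftP: hI => /(_ radius (conj ul u1)).
Qed.

Lemma measurable_bdry : measurable_fun circle (fun t => Re (bdry f t)) /\
  measurable_fun circle (fun t => Im (bdry f t)).
Proof.
have key (p : R[i] -> R) : (forall (T : Type) (F : set_system T) (FF : ProperFilter F)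
      (g : T -> R[i]) z, g @ F --> z -> p (g x) @[x --> F] --> p z) ->
    measurable_fun circle (fun t => p (bdry f t)).
  move=> pc.
  (* Equal to the constant [p point] on the divergence set and to the value at [radius n] off it, so
     [phi] converges to [p (bdry f t)] at every [t] of the circle. *)
  pose phi n t := \1_divergence_set t * p point +
    (1 - \1_divergence_set t) * p (radial c (radius n) t).
  have mD : measurable_fun setT (\1_divergence_set : R -> R).
    exact: measurable_indic measurable_divergence_set.
  apply: (@measurable_fun_cvg _ _ _ _ phi).
    move=> n; apply: measurable_funTS; apply: measurable_funD.
      by apply: measurable_funM; [exact: mD|exact: measurable_cst].
    apply: measurable_funM.
      by apply: measurable_funB; [exact: measurable_cst|exact: mD].
    apply: continuous_measurable_fun => t.
    exact: (pc _ _ (nbhs_pfilter t) _ _ (radial_cts_angle cs (radius01 n) (t:=t))).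
  move=> t /=; rewrite in_itv/= => t01; rewrite /phi.
  have [tD|tD] := pselect (divergence_set t).
    rewrite (bdry_divergent tD) indicE mem_set//=.
    under eq_fun do rewrite mul1r subrr mul0r addr0.
    exact: cvg_cst.
  rewrite indicE memNset//=.
  under eq_fun do rewrite mul0r add0r subr0 mul1r.
  apply: pc; exact: (radius_cvg (bdry_radial t01 tD)).
split; apply: key => T F FF g z; [exact: cvgC_Re|exact: cvgC_Im].
Qed.

(** Off the null divergence set, [bdry f - tpoly N c] is the radial limit of the tail series.
    Bounding the tail, rather than [f] alone, makes the partial sums approximate [bdry f] in mean
    square. *)
Lemma bdry_tail_integral_le N :
  (\int[mu]_(t in circle) (normc (bdry f t - tpoly N c t) ^+ 2)%:E <=
   (2 * pi * (s - series (fun l => normc (c l) ^+ 2) N))%:E)%E /\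
  measurable_fun circle (fun t => Re (bdry f t - tpoly N c t)) /\
  measurable_fun circle (fun t => Im (bdry f t - tpoly N c t)).
Proof.
have tc t := cvg_tpoly (N:=N) (c:=c) (t:=t).
have [mR mIm] := measurable_bdry.
have mR' : measurable_fun circle (fun t => Re (bdry f t - tpoly N c t)).
  rewrite (_ : (fun t => Re _) = fun t => Re (bdry f t) - Re (tpoly N c t)); last first.
    by apply/funext => t; rewrite ReD ReN.
  apply: measurable_funB; first exact: mR.
  apply: measurable_funTS; apply: continuous_measurable_fun => t.
  exact: (@cvgC_Re _ _ _ (nbhs_pfilter t) _ _ (tc t)).
have mI' : measurable_fun circle (fun t => Im (bdry f t - tpoly N c t)).
  rewrite (_ : (fun t => Im _) = fun t => Im (bdry f t) - Im (tpoly N c t)); last first.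
    by apply/funext => t; rewrite ImD ImN.
  apply: measurable_funB; first exact: mIm.
  apply: measurable_funTS; apply: continuous_measurable_fun => t.
  exact: (@cvgC_Im _ _ _ (nbhs_pfilter t) _ _ (tc t)).
split; last by split.
have ts := @nsq_tail _ _ _ N cs.
apply: (@fatou_bound _ _ divergence_set (fun n t => normc (radial (tail_coef N c) (radius n) t) ^+ 2)).
- exact: mI.
- exact: measurable_divergence_set.
- exact: divergence_set_measure0.
- move=> n; apply: measurable_funTS; apply: continuous_measurable_fun => t.
  apply: cvg_sqr.
  exact: (@cvgC_norm _ _ _ (nbhs_pfilter t) _ _ (radial_cts_angle ts (radius01 n) (t:=t))).
- by move=> n t; exact: sqr_ge0.
- exact: measurable_sqr_normc.
- by move=> t; exact: sqr_ge0.
- by move=> n; exact: radial_sqr_integral_le ts (radius01 n).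
- move=> t /=; rewrite in_itv/= => t01 tD; apply: cvg_sqr; apply: cvgC_norm.
  rewrite (_ : (fun n => radial _ _ _) = fun n => radial c (radius n) t -
     \sum_(l < N) c l * ((radius n)%:C * expi t) ^+ l); last first.
    apply/funext => n; rewrite /radial (@pser_tail _ _ _ _ N (nsq_bounded cs))//.
    by have /andP[r0 r1] := radius01 n; rewrite normc_radial.
  apply: cvgB; first exact: (radius_cvg (bdry_radial t01 tD)).
  have rC : (radius n)%:C * expi t @[n --> \oo] --> expi t.
    rewrite -[X in _ --> X](mul1r (expi t)); apply: cvgM; last exact: cvg_cst.
    have := @radius_cvg (fun r => r%:C) 1; apply.
    apply: (@cvg_real_complex _ _ _ _ id 1); exact: cvg_at_left_filter.
  apply: (@cvg_sum_ord _ R[i] _ _ _ N (fun l n => c l * ((radius n)%:C * expi t) ^+ l)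
    (fun l => c l * expi t ^+ l)) => l.
  apply: cvgM; first exact: cvg_cst.
  elim: l => [|l IH]; first by under eq_fun do rewrite expr0; exact: cvg_cst.
  under eq_fun do rewrite exprS; rewrite exprS.
  by apply: cvgM; [exact: rC|exact: IH].
Qed.

End one_function.
End boundary_values.

(** * The boundary inner product with a Szego kernel *)

Section hardy_inner_product.
Context {R : realType}.
Local Notation mu := (@lebesgue_measure R).
Local Notation circle := (`[0, 2 * pi]%classic : set (measurableTypeR R)).

Let mI : measurable circle := measurable_itv _.

Lemma fine_le_bound (x : \bar R) (b : R) : (0 <= x)%E -> (x <= b%:E)%E -> fine x <= b.
Proof. by case: x. Qed.

Section one_function.
Variables (f : R[i] -> R[i]) (c : nat -> R[i]) (s : R).
Hypotheses (cs : is_nsq c s) (fc : forall z, unit_disc z -> f z = pser c z).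

Lemma bdry_tail_Rintegral_le N :
  mu.-integrable circle (EFin \o (fun t => normc (bdry f t - tpoly N c t) ^+ 2)) /\
  \int[mu]_(t in circle) (normc (bdry f t - tpoly N c t) ^+ 2) <=
    2 * pi * (s - series (fun l => normc (c l) ^+ 2) N).
Proof.
have [le [mR mIm]] := bdry_tail_integral_le cs fc N.
split; last first.
  apply: fine_le_bound le; apply: integral_ge0 => t _.
  by rewrite lee_fin sqr_ge0.
apply/integrableP; split.
  apply/measurable_EFinP.
  exact: (measurable_sqr_normc mR mIm).
apply: le_lt_trans (ltry _); apply: le_trans le.
under eq_integral do rewrite /= ger0_norm ?sqr_ge0//.
exact: lexx.
Qed.

Lemma h2norm_le : h2norm f <= Num.sqrt s.
Proof.
apply: ler_wsqrtr.
have -> : Re (h2dot f f) = (2 * pi)^-1 * \int[mu]_(t in circle) (normc (bdry f t) ^+ 2).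
  rewrite /h2dot /Cintegral ReM /= mul0r subr0; congr (_ * _).
  apply: eq_Rintegral => t _.
  have h : Re (bdry f t * conjc (bdry f t)) = normc (bdry f t) ^+ 2 by rewrite mulc_conj.
  exact: h.
have [_] := bdry_tail_Rintegral_le 0.
have -> : series (fun l => normc (c l) ^+ 2) 0 = 0 by rewrite /series/= big_geq.
rewrite subr0; under eq_Rintegral do rewrite /tpoly big_ord0 subr0.
have pi0 : 0 < 2 * pi :> R by rewrite mulr_gt0// pi_gt0.
by move=> h; rewrite ler_pdivrMl.
Qed.

Variable a : R[i].
Hypothesis a1 : normc a < 1.
Let k := Num.sqrt (1 - normc a ^+ 2).
Let A := (1 - normc a)^-1.
Let ecoef l : R[i] := k%:C * conjc (a ^+ l).
Let E t : R[i] := szego a (expi t).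

Let k0 : 0 <= k. Proof. exact: sqrtr_ge0. Qed.

Let k1 : k <= 1.
Proof.
by rewrite -[leRHS]sqrtr1 ler_wsqrtr// gerBl sqr_ge0.
Qed.

Let A0 : 0 < A. Proof. by rewrite invr_gt0 subr_gt0. Qed.

Let den t : R[i] := 1 - conjc a * expi t.

Let den_ge t : 1 - normc a <= normc (den t).
Proof.
rewrite lerBlDr; have := normc_triangle_dist 1 (conjc a * expi t).
by rewrite normc_one normcM normc_conj normc_expi mulr1 addrC.
Qed.

Let den0 t : den t != 0.
Proof. by apply: one_sub_conjM_neq0; rewrite ?normc_expi. Qed.

Lemma szego_expi_cvg t :
  (fun r : R => szego a (r%:C * expi t)) @ (1 : R)^'- --> E t.
Proof.
have rC : r%:C * expi t @[r --> (1 : R)^'-] --> (1%:C * expi t : R[i]).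
  apply: cvgM; last exact: cvg_cst.
  by apply: (@cvg_real_complex _ _ _ _ id 1); exact: cvg_at_left_filter.
rewrite mul1r in rC.
apply: cvgM; first exact: cvg_cst.
apply: cvgV; first exact: den0.
by apply: cvgB; [exact: cvg_cst|apply: cvgM; [exact: cvg_cst|exact: rC]].
Qed.

Lemma bdry_szego t : bdry (szego a) t = E t.
Proof. by have h := szego_expi_cvg (t := t); rewrite /bdry (cvgC_lim h). Qed.

Let E_cts t : E u @[u --> t] --> E t.
Proof.
apply: cvgM; first exact: cvg_cst.
apply: cvgV; first exact: den0.
by apply: cvgB; [exact: cvg_cst|apply: cvgM; [exact: cvg_cst|exact: cvg_expi]].
Qed.

Let E_le t : normc (E t) <= A.
Proof.
rewrite /E /szego normcM normcV normc_real ger0_norm ?sqrtr_ge0//.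
apply: (@le_trans _ _ (1 * (normc (den t))^-1)).
  by apply: ler_wpM2r; [rewrite invr_ge0; exact: normc_ge0|exact: k1].
rewrite mul1r lef_pV2 ?posrE; [exact: den_ge| |by rewrite subr_gt0].
by apply: lt_le_trans (den_ge t); rewrite subr_gt0.
Qed.

(** The remainder of the geometric series of [E] is [(a^* e^(it))^N E t]. *)
Let E_tail N t : normc (E t - tpoly N ecoef t) <= A * normc a ^+ N.
Proof.
have -> : E t - tpoly N ecoef t = (conjc a * expi t) ^+ N * E t.
  have -> : tpoly N ecoef t = k%:C * \sum_(l < N) (conjc a * expi t) ^+ l.
    rewrite /tpoly mulr_sumr; apply: eq_bigr => l _.
    have aX : conjc (a ^+ l) = conjc a ^+ l by exact: rmorphXn.
    by rewrite /ecoef aX exprMn mulrA.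
  have := subrX1 (conjc a * expi t) N; rewrite /E /szego -/k -/(den t).
  have -> : conjc a * expi t = 1 - den t by rewrite /den opprB addrCA subrr addr0.
  move: (den t) (den0 t) => D d0; move: (\sum_(l < N) _) ((1 - D) ^+ N) => S x xS.
  have -> : x = 1 - D * S by rewrite -(subrK 1 x) xS; ring.
  by field; exact: d0.
rewrite normcM normc_exp normcM normc_conj normc_expi mulr1 mulrC.
by apply: ler_wpM2r; [rewrite exprn_ge0// normc_ge0|exact: E_le].
Qed.

Lemma error_arith (B w eta ID sN SN x s' : R) : 0 < B -> 0 < w -> 0 < eta ->
  0 <= x -> ID <= 2 * w * sN -> SN <= s' ->
  2 * (B * (eta / 2 * (2 * w) + 1 / (2 * eta) * ID) + 0 * (2 * w)) +
  2 * (B * x * (1 / 2 * (2 * w) + 1 / (2 * 1) * (2 * w * SN)) + 0 * (2 * w)) <=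
  2 * B * w * (eta + sN / eta + x * (1 + s')).
Proof.
move=> B0 w0 eta0 x0 hI hS; rewrite -subr_ge0.
set rhs := (X in 0 <= X).
have -> : rhs = B / eta * (2 * w * sN - ID) + 2 * B * w * x * (s' - SN).
  by rewrite /rhs; field; rewrite gt_eqF.
apply: addr_ge0; apply: mulr_ge0; rewrite ?subr_ge0//.
  by apply: divr_ge0; exact: ltW.
apply: mulr_ge0; last exact: x0.
by apply: mulr_ge0; [apply: mulr_ge0; [rewrite ler0n|exact: ltW]|exact: ltW].
Qed.

(** The integrand splits into three: the error of [f] times the conjugate of [E], a product of two
    polynomials, computed exactly by orthogonality, and a polynomial times the tail of [E].
    [half_amgm] handles the outer two, with parameter [eta] for the first and 1 for the last. *)
Lemma h2dot_szego_error N eta : 0 < eta ->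
  normc (2%:R * pi%:C * h2dot f (szego a) -
         (2 * pi)%:C * (k%:C * \sum_(l < N) c l * a ^+ l)) <=
  2 * A * pi * (eta + (s - series (fun l => normc (c l) ^+ 2) N) / eta
    + normc a ^+ N * (1 + s)).
Proof.
move=> eta0; have pi0 : 0 < pi :> R := pi_gt0 R.
have ab : 0 < 2 * pi :> R by rewrite mulr_gt0.
have pab : expi 0 = expi (2 * pi) :> R[i] by rewrite expi0 expi_pi2.
pose d t := bdry f t - tpoly N c t.
have [di dle] := bdry_tail_Rintegral_le N.
have [_ [mdR mdI]] := bdry_tail_integral_le cs fc N.
have ci : mu.-integrable circle (EFin \o (fun=> 1)).
  by apply: continuous_itv_integrable => t; exact: cvg_cst.
have p2i : mu.-integrable circle (EFin \o (fun t => normc (tpoly N c t) ^+ 2)).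
  by apply: continuous_itv_integrable => t; apply: cvg_sqr; exact: continuous_normc_tpoly.
have i1E : \int[mu]_(t in circle) 1 = 2 * pi.
  by rewrite Rintegral_cst//= lebesgue_measure_itv/= lte_fin ab /= subr0 mul1r.
have [H1i H1E] := integrable_comb (eta / 2) (1 / (2 * eta)) mI ci di.
have [H2i H2E] := integrable_comb (1 / 2) (1 / (2 * 1)) mI ci p2i.
(* The zero coefficient fits a scalar multiple into the shape of [integrable_comb]; it accounts for
   the terms [0 * 1] below. *)
have [H1i' H1E'] := integrable_comb A 0 mI H1i ci.
have [H2i' H2E'] := integrable_comb (A * normc a ^+ N) 0 mI H2i ci.
have cE t := @cvg_conj _ _ _ (nbhs_pfilter t) _ _ (@E_cts t).
have ce t := cvg_tpoly (N:=N) (c:=ecoef) (t:=t).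
have cce t := @cvg_conj _ _ _ (nbhs_pfilter t) _ _ (ce t).
have cp t := cvg_tpoly (N:=N) (c:=c) (t:=t).
pose kf t := tpoly N c t * conjc (tpoly N ecoef t).
pose qf t := tpoly N c t * (conjc (E t) - conjc (tpoly N ecoef t)).
have ki : Cintegrable circle kf.
  by apply: continuous_Cintegrable => t; apply: cvgM; [exact: cp|exact: cce].
have qi : Cintegrable circle qf.
  apply: continuous_Cintegrable => t; apply: cvgM; first exact: cp.
  by apply: cvgB; [exact: cE|exact: cce].
have mE (p : R[i] -> R) : (forall (T : Type) (F : set_system T) (FF : ProperFilter F)
      (g : T -> R[i]) z, g @ F --> z -> p (g x) @[x --> F] --> p z) ->
    measurable_fun circle (fun t => p (conjc (E t))).
  move=> pc; apply: measurable_funTS; apply: continuous_measurable_fun => t.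
  exact: (pc _ _ (nbhs_pfilter t) _ _ (cE t)).
have mER := mE (@complex.Re R) (fun T F FF g z => @cvgC_Re _ T F FF g z).
have mEI := mE (@complex.Im R) (fun T F FF g z => @cvgC_Im _ T F FF g z).
have dE_le t : normc (d t * conjc (E t)) <=
    A * (eta / 2 * 1 + 1 / (2 * eta) * normc (d t) ^+ 2) + 0 * 1.
  rewrite mul0r addr0 normcM normc_conj mulrC.
  apply: le_trans (_ : A * normc (d t) <= _).
    by apply: ler_wpM2r; [exact: normc_ge0|exact: E_le].
  by apply: ler_wpM2l; [exact: ltW|exact: half_amgm].
have q_le t : normc (qf t) <=
    A * normc a ^+ N * (1 / 2 * 1 + 1 / (2 * 1) * normc (tpoly N c t) ^+ 2) + 0 * 1.
  rewrite mul0r addr0 /qf normcM mulrC.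
  have -> : normc (conjc (E t) - conjc (tpoly N ecoef t)) = normc (E t - tpoly N ecoef t).
    by rewrite -[RHS]normc_conj; congr normc; symmetry; exact: rmorphB.
  apply: le_trans (_ : A * normc a ^+ N * normc (tpoly N c t) <= _).
    by apply: ler_wpM2r; [exact: normc_ge0|exact: E_tail].
  apply: ler_wpM2l; last by apply: half_amgm; exact: ltr01.
  by apply: mulr_ge0; [exact: ltW|rewrite exprn_ge0// normc_ge0].
have dEi : Cintegrable circle (fun t => d t * conjc (E t)).
  split.
    apply: le_integrable H1i'; [exact: mI| |].
      apply/measurable_EFinP.
      rewrite (_ : (fun t => Re _) = fun t => Re (d t) * Re (conjc (E t)) -
        Im (d t) * Im (conjc (E t))); last by apply/funext => t; rewrite ReM.
      by apply: measurable_funB; apply: measurable_funM.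
    move=> t _ /=; rewrite lee_fin; apply: le_trans (ler_norm _).
    by apply: le_trans (dE_le t); exact: normRe_le.
  apply: le_integrable H1i'; [exact: mI| |].
    apply/measurable_EFinP.
    rewrite (_ : (fun t => Im _) = fun t => Re (d t) * Im (conjc (E t)) +
      Im (d t) * Re (conjc (E t))); last by apply/funext => t; rewrite ImM.
    by apply: measurable_funD; apply: measurable_funM.
  move=> t _ /=; rewrite lee_fin; apply: le_trans (ler_norm _).
  by apply: le_trans (dE_le t); exact: normIm_le.
have hE : Cintegral circle (fun t => bdry f t * conjc (bdry (szego a) t)) =
    Cintegral circle (fun t => d t * conjc (E t)) +
    (Cintegral circle kf + Cintegral circle qf).
  rewrite -CintegralD// -CintegralD//; last exact: CintegrableD.
  congr Cintegral; apply/funext => t; rewrite bdry_szego /d /kf /qf.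
  by move: (conjc (E t)) (conjc _) (bdry f t) (tpoly N c t) => *; ring.
have kE : Cintegral circle kf = (2 * pi)%:C * (k%:C * \sum_(l < N) c l * a ^+ l).
  rewrite [LHS](Cintegral_tpolyJ ab pab N c ecoef) subr0; congr (_ * _).
  have ecJ l : conjc (ecoef l) = k%:C * a ^+ l.
    by rewrite /ecoef conjcM conjc_real; congr (_ * _); exact: conjcK.
  rewrite mulr_sumr; apply: eq_bigr => l _.
  transitivity (c l * (k%:C * a ^+ l)); first by congr (_ * _); exact: ecJ.
  by move: (k%:C) (a ^+ l) => *; ring.
have -> : 2%:R * pi%:C * h2dot f (szego a) =
    Cintegral circle (fun t => bdry f t * conjc (bdry (szego a) t)).
  rewrite /h2dot mulrA.
  have -> : 2%:R * pi%:C * ((2 * pi)^-1)%:C = 1 :> R[i].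
    rewrite -[2%:R](rmorph_nat (real_complex R)) -!rmorphM /= divff ?rmorph1//.
    by rewrite gt_eqF.
  by rewrite mul1r.
rewrite hE kE.
have alg (x y z : R[i]) : x + (y + z) - y = x + z by ring.
rewrite alg; apply: le_trans (normc_triangle _ _) _.
have b1 := normc_Cintegral_le mI dEi H1i' (fun t _ => dE_le t).
have b2 := normc_Cintegral_le mI qi H2i' (fun t _ => q_le t).
apply: le_trans (lerD b1 b2) _.
rewrite H1E' H2E' H1E H2E i1E (Rintegral_tpoly_sqr ab pab N c) subr0.
have Sle : \sum_(l < N) normc (c l) ^+ 2 <= s.
  by have := series_nsq_le N cs; rewrite /series/= big_mkord.
move: dle; set ID := \int[mu]_(t in _) _; set sN := s - _ => dle.
move: Sle; set SN := \sum_(l < N) _ => Sle.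
have aN0 : 0 <= normc a ^+ N by rewrite exprn_ge0// normc_ge0.
by apply: error_arith.
Qed.

(** For fixed [eta] the length of the partial sums tends to infinity, which removes both the tail
    divided by [eta] and the power of [|a|]; only then does [eta] tend to 0. *)
Lemma h2dot_szego : h2dot f (szego a) = k%:C * f a.
Proof.
have pi0 : 0 < pi :> R := pi_gt0 R.
have fa : f a = pser c a by exact: fc.
pose P := 2 * A * pi; have P0 : 0 < P by do 2 (apply: mulr_gt0 => //).
pose L n := normc (2%:R * pi%:C * h2dot f (szego a) -
         (2 * pi)%:C * (k%:C * \sum_(l < n) c l * a ^+ l)).
have Lc : L @ \oo --> normc (2%:R * pi%:C * h2dot f (szego a) - (2 * pi)%:C * (k%:C * f a)).
  apply: cvgC_norm; apply: cvgB; first exact: cvg_cst.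
  apply: cvgM; first exact: cvg_cst.
  apply: cvgM; first exact: cvg_cst.
  have := pser_cvg (nsq_bounded cs) a1; rewrite -fa.
  by rewrite (_ : series _ = fun n => \sum_(l < n) c l * a ^+ l)//; apply/funext => n;
     rewrite /series/= big_mkord.
have bound eta : 0 < eta -> normc (2%:R * pi%:C * h2dot f (szego a) -
    (2 * pi)%:C * (k%:C * f a)) <= P * eta.
  move=> eta0.
  have Uc : (fun n => P * (eta + (s - series (fun l => normc (c l) ^+ 2) n) / eta
      + normc a ^+ n * (1 + s))) @ \oo --> P * (eta + (s - s) / eta + 0 * (1 + s)).
    apply: cvgM; first exact: cvg_cst.
    apply: cvgD; last first.
      apply: cvgM; last exact: cvg_cst.
      by apply: cvg_expr; rewrite ger0_norm ?normc_ge0.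
    apply: cvgD; first exact: cvg_cst.
    by apply: cvgM; [apply: cvgB; [exact: cvg_cst|exact: cs]|exact: cvg_cst].
  rewrite subrr !mul0r !addr0 in Uc.
  by apply: (ler_cvg_to Lc Uc); apply: nearW => n; exact: h2dot_szego_error.
have z0 : normc (2%:R * pi%:C * h2dot f (szego a) - (2 * pi)%:C * (k%:C * f a)) <= 0.
  apply/ler_addgt0Pr => e e0; rewrite add0r.
  have e1 : P * (e / P) = e by rewrite mulrC divfK// gt_eqF.
  by have := bound (e / P) (divr_gt0 e0 P0); rewrite e1.
have eC : (2 * pi)%:C = 2%:R * pi%:C :> R[i].
  by rewrite rmorphM; congr (_ * _); exact: (rmorph_nat (real_complex R) 2).
have nz : 2%:R * pi%:C != 0 :> R[i].
  apply: mulf_neq0; first by rewrite pnatr_eq0.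
  by rewrite -normc_eq0 normc_real normr_eq0 gt_eqF.
have e0 : 2%:R * pi%:C * h2dot f (szego a) - 2%:R * pi%:C * (k%:C * f a) = 0.
  have n0 : normc (2%:R * pi%:C * h2dot f (szego a) - (2 * pi)%:C * (k%:C * f a)) = 0.
    by apply/eqP; rewrite eq_le z0 normc_ge0.
  by have := eq0_normc n0; rewrite eC.
apply: (mulfI nz); apply/eqP; rewrite -subr_eq0 e0; exact: eqxx.
Qed.

End one_function.
End hardy_inner_product.

(** * Convergence of the adaptive decomposition *)

Section adaptive_decomposition.
Context {R : realType}.

Local Notation kap a := (Num.sqrt (1 - normc a ^+ 2)).

Lemma reduce_hardy (f : R[i] -> R[i]) c s (a : R[i]) : is_nsq c s ->
  (forall z, unit_disc z -> f z = pser c z) -> unit_disc a ->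
  exists u t, [/\ is_nsq u t, forall z, unit_disc z -> reduce f a z = pser u z,
    t = s - normc ((kap a)%:C * f a) ^+ 2 &
    exists W, [/\ W 0%N = 0, normc (W n) @[n --> \oo] --> (0 : R),
      c = plus_coef a ((kap a)%:C * f a) W & u = minus_coef a W]].
Proof.
move=> cs fc a1; have [W [W0 Wc cE]] := plus_coef_split cs a1.
have h := reduce_pser fc a1 (h2dot_szego cs fc a1) W0 Wc cE.
have fa := fc a a1; rewrite -fa in cE.
exists (minus_coef a W), (s - normc ((kap a)%:C * f a) ^+ 2); split => //.
  by apply: nsq_minus_of_plus => //; rewrite -cE.
by exists W.
Qed.

Lemma remainder_hardy (f : R[i] -> R[i]) (a : nat -> R[i]) n : hardy2 f ->
  (forall k, (k < n)%N -> unit_disc (a k)) -> hardy2 (remainder a f n).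
Proof.
move=> hf; elim: n => [//|n IH] an.
have /hardy2_nsq[c [s [cs fc]]] := IH (fun k kn => an k (ltnW kn)).
have [u [t [us rE _ _]]] := reduce_hardy cs fc (an n (ltnSn n)).
by apply/hardy2_nsq; exists u, t.
Qed.

Lemma remainder_chain (f : R[i] -> R[i]) (a : nat -> R[i]) : hardy2 f ->
  (forall k, unit_disc (a k)) ->
  exists c s, afd_chain c a (fun k => (kap (a k))%:C * remainder a f k (a k)) s /\
    forall k z, unit_disc z -> remainder a f k z = pser (c k) z.
Proof.
move=> /hardy2_nsq[c0 [s0 [cs0 fc0]]] ad.
pose P k (x : (nat -> R[i]) * R) := is_nsq x.1 x.2 /\
  forall z, unit_disc z -> remainder a f k z = pser x.1 z.
pose sg k := (kap (a k))%:C * remainder a f k (a k).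
pose rel k (x y : (nat -> R[i]) * R) := y.2 = x.2 - normc (sg k) ^+ 2 /\
  exists W, [/\ W 0%N = 0, normc (W n) @[n --> \oo] --> (0 : R),
      x.1 = plus_coef (a k) (sg k) W & y.1 = minus_coef (a k) W].
(* The choice ranges over all pairs, so outside the invariant [P] an arbitrary value is returned;
   [xP] shows that the recursion stays inside. *)
have /choice[F FP] : forall kx : nat * ((nat -> R[i]) * R), exists y,
    P kx.1 kx.2 -> P kx.1.+1 y /\ rel kx.1 kx.2 y.
  move=> [k x]; have [[xs xc]|nP] := pselect (P k x); last by exists x => /nP.
  have [u [t [us rE tE W]]] := reduce_hardy xs xc (ad k).
  by exists (u, t) => _; split.
pose x := fix x n := if n is m.+1 then F (m, x m) else (c0, s0).
have xP n : P n (x n).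
  by elim: n => [//|n IH]; have [] := FP (n, x n) IH.
have xr n : rel n (x n) (x n.+1) by have [] := FP (n, x n) (xP n).
exists (fun n => (x n).1), (fun n => (x n).2); split; last by move=> k; case: (xP k).
split.
- exact: ad.
- by move=> k; case: (xP k).
- by move=> k; case: (xr k).
- by move=> k; case: (xr k).
Qed.

End adaptive_decomposition.

Unset Implicit Arguments.

Theorem theorem3p1 (R : realType) (f : R[i] -> R[i]) (hf : hardy2 f) :
  (forall (a : nat -> R[i]) (n : nat),
      (forall k, (k < n)%N -> is_maximizer (remainder a f k) (a k)) ->
      hardy2 (remainder a f n) /\
      exists b : R[i], is_maximizer (remainder a f n) b) /\
  (forall a : nat -> R[i],
      (forall k, is_maximizer (remainder a f k) (a k)) ->
      (fun n => h2norm (fun z => f z -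
         \sum_(k < n) h2dot (remainder a f k) (szego (a k))
                      * blaschke_atom a k z)) @ \oo --> (0 : R)).
Proof.
split=> [a n amax|a amax].
  have hr : hardy2 (remainder a f n).
    by apply: remainder_hardy => // k /amax[].
  split=> //; have /hardy2_nsq[c [s [cs fc]]] := hr.
  exact: maximizer_exists cs fc.
have ad k : unit_disc (a k) by case: (amax k).
have [c [s [ch rc]]] := remainder_chain hf ad.
have s0 : s @ \oo --> (0 : R).
  (* Here maximality is used: the value at any [b] is dominated by the one at [a k], which is
     [|<f_k, e_(a_k)>|^2] by [sqr_kap]. *)
  apply: (greedy_cvg ch) => k b b1; have [_ /(_ b b1)] := amax k.
  rewrite (rc k b b1) => h; apply: le_trans h _.
  rewrite normcM exprMn normc_real ger0_norm ?sqrtr_ge0// sqr_kap//; exact: ad.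
have sq0 : Num.sqrt (s n) @[n --> \oo] --> (0 : R).
  have : Num.sqrt (s n) @[n --> \oo] --> Num.sqrt (0 : R).
    by apply: continuous_cvg s0; exact: sqrt_continuous.
  by rewrite sqrtr0.
apply: (@squeeze_cvgr _ _ _ _ (cst 0) (fun n => Num.sqrt (s n))) => //; last exact: cvg_cst.
apply: nearW => n /=; apply/andP; split; first exact: sqrtr_ge0.
have [r [rs _ rE _]] := chain_residual ch n 0.
(* The residual sequence [r] is the power series of the error of the partial sum, so the error has
   boundary norm at most [Num.sqrt (s n)]. *)
apply: (@h2norm_le _ _ r (s n)); first exact: rs.
move=> z z1; rewrite (rE z z1) -(rc 0%N z z1); congr (_ - _).
apply: eq_bigr => k _; rewrite add0n.
have ck := @chain_nsq R c a _ s ch k.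
by rewrite (h2dot_szego ck (rc k) (ad k)).
Qed.
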